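(* Let $d\ge 3$ be a fixed integer, let $\varepsilon>0$ be a fixed sufficiently small constant, and let $b>0$ be a fixed, sufficiently large constant (depending on $d$ and $\varepsilon$). Let $p=p(n)$ be primes with $p\to\infty$ and $p\le n^{1/3-\varepsilon}$. Let $\mathcal{E}$ be the set of equidistributed tuples, i.e. $p$-tuples $(n_0,\dots,n_{p-1})$ of non-negative integers with $\sum_j n_j=n$ and $\sum_{j=0}^{p-1}\left(\frac{n_j}{n}-\frac1p\right)^2\le \frac{b\log n}{n}$. Then, as $n\to\infty$, $$\sum_{(n_0,\dots,n_{p-1})\in\mathcal{E}} \binom{n}{n_0,\dots,n_{p-1}}\frac{p^{(d-1)n}\prod_{j=0}^{p-1}(dn_j)!}{(dn)!}\,\mathbb{P}\big(X_1+\dots+X_n=(dn_0,\dots,dn_{p-1})\big)\le 1+o(1).$$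
   Context: For $\mathbf{x}=(x_1,\dots,x_d)\in\mathbb{F}_p^d$ let $\Phi(\mathbf{x})=(m_0,\dots,m_{p-1})\in\mathbb{Z}_{\ge0}^p$, where $m_j$ is the number of coordinates of $\mathbf{x}$ equal to $j$ (elements of $\mathbb{F}_p$ identified with $\{0,\dots,p-1\}$). Let $\mathcal{U}_{d,p}$ be the multiset $\{\Phi(\mathbf{x}):\mathbf{x}\in\mathbb{F}_p^d,\ \sum_{i=1}^d x_i=0\}$, which has $p^{d-1}$ elements counted with multiplicity. $X_1,\dots,X_n$ are independent random vectors, each uniformly distributed over the multiset $\mathcal{U}_{d,p}$. *)

(* Defs.v *)
From HB Require Import structures.
From mathcomp Require Import all_boot all_order all_algebra.
From mathcomp Require Import all_classical all_reals all_analysis.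

Set Implicit Arguments.
Unset Strict Implicit.
Unset Printing Implicit Defensive.

Import Order.TTheory GRing.Theory Num.Theory.
Import numFieldNormedType.Exports.

Local Open Scope classical_set_scope.
Local Open Scope ring_scope.

Section Counts.
Variables (d p : nat).

(* 'F_p is implemented as an ordinal type, so [x 0 i == j :> nat] is the
   identification of F_p with {0, ..., p-1} when p is prime. *)
Definition Phi (x : 'rV['F_p]_d) : {ffun 'I_p -> nat} :=
  [ffun j : 'I_p => #|[set i : 'I_d | x 0 i == j :> nat]%SET|].

(* A multiset, represented by a list with repetitions. *)
Definition U : seq {ffun 'I_p -> nat} :=
  [seq Phi x | x : 'rV['F_p]_d <- enum 'rV['F_p]_d & \sum_(i < d) x 0 i == 0].

End Counts.

Section DiscreteRandomVariables.
Context {disp : measure_display} {T : measurableType disp} {R : realType}.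
Variable (P : probability T R).

(* Measurability with respect to the discrete sigma-algebra on V. *)
Definition discrete_rv (V : Type) (X : T -> V) : Prop :=
  forall A : set V, measurable (X @^-1` A).

Definition uniform_over (V : eqType) (s : seq V) (X : T -> V) : Prop :=
  forall v : V,
    P [set w | X w = v] = ((count_mem v s)%:R / (size s)%:R)%:E.

Definition mutually_independent (I : finType) (V : Type) (X : I -> T -> V) :
    Prop :=
  forall (J : {set I}) (A : I -> set V),
    P (\bigcap_(i in [set` J]) (X i @^-1` A i)) =
    (\prod_(i in J) P (X i @^-1` A i))%E.

End DiscreteRandomVariables.

Section Tuples.
Context {R : realType}.

(* Non-negative integers with sum n are at most n, so the p-tuples of
   non-negative integers with sum n all live in the finite type
   {ffun 'I_p -> 'I_n.+1}. *)
Definition equidistributed (b : R) (n p : nat) :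
    {set {ffun 'I_p -> 'I_n.+1}} :=
  [set m : {ffun 'I_p -> 'I_n.+1} |
    ((\sum_(j < p) m j)%N == n) &&
    (\sum_(j < p) ((m j)%:R / n%:R - p%:R^-1) ^+ 2
       <= b * ln n%:R / n%:R :> R)]%SET.

Definition multinomial (n p : nat) (m : {ffun 'I_p -> 'I_n.+1}) : R :=
  n`!%:R / (\prod_(j < p) (m j)`!)%N%:R.

Definition equidistributed_sum (d : nat) (b : R) (n p : nat)
    (disp : measure_display) (T : measurableType disp) (P : probability T R)
    (X : 'I_n -> T -> {ffun 'I_p -> nat}) : R :=
  \sum_(m in equidistributed b n p)
    multinomial m
    * ((p ^ ((d - 1) * n))%N%:R * (\prod_(j < p) (d * m j)`!)%N%:R
         / (d * n)`!%N%:R)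
    * fine (P [set w | forall j : 'I_p, (\sum_(i < n) X i w j = d * m j)%N]).

End Tuples.

(* Main.v *)
Require Import Defs.
From HB Require Import structures.
From mathcomp Require Import all_boot all_order all_algebra.
From mathcomp Require Import all_classical all_reals all_analysis.
From mathcomp Require Import cyclic separable algC cyclotomic complex ring lra zify.

Set Implicit Arguments.
Unset Strict Implicit.
Unset Printing Implicit Defensive.

Import Order.TTheory GRing.Theory Num.Theory.
Import numFieldNormedType.Exports.

Local Open Scope classical_set_scope.
Local Open Scope ring_scope.

(* Write N = d n, M = (d n_0, ..., d n_{p-1}) and q_j = n_j / n. Up to the factor
   q^M, the number of n-tuples of zero-sum vectors with joint type M is the
   average over a large finite torus mu_L^p of F^n times a unimodular factor,
   where p F = sum_k Z_k^d and Z_k = sum_j q_j zeta_j omega^(j k) is a Fourier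
   transform with sum_k |Z_k|^2 = p sum_j q_j^2 <= 1 + b p log n / n.
   If all |Z_k|^2 < 1 - C p log n / n then |p F|^n is negligible. Otherwise one
   |Z_k| is near 1; there are p symmetric such regions, and for k = 0 the other
   Z_k contribute at most n (C' p log n / n)^(3/2) = o(1) to log |p F|^n, as
   d >= 3 and p <= n^(1/3 - eps). It remains to bound the average of |Z_0|^N by
   (1 + o(1)) times the probability that a multinomial(N, q) vector equals its
   mode M. Near the peak |Z_0|^N is at most the average over the rotations of
   zeta of prod_j ((1 + Re zeta_j) / 2)^(2 M_j), divided by the average of
   ((1 + Re zeta) / 2)^(2 N); both averages are products of central binomial
   probabilities, which a Stirling type estimate compares with the mode.
   So the probability in the sum is at most p (1 + o(1)) times the multinomial
   one, and it vanishes unless p divides sum_j j n_j; this happens for exactly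
   a fraction 1/p of all words in F_p^n, which compensates the factor p. *)

(** * Complex numbers and roots of unity *)

Section ComplexNorm.
Context {R : rcfType}.
Implicit Types (x y z : R[i]).

Lemma normc_ge0 z : 0 <= Normc.normc z.
Proof. by case: z => a b; exact: sqrtr_ge0. Qed.

Lemma normcX z n : Normc.normc (z ^+ n) = Normc.normc z ^+ n.
Proof.
elim: n => [|n IHn]; first exact: Normc.normc1.
by rewrite !exprS Normc.normcM IHn.
Qed.

Lemma normc_prod (I : Type) (r : seq I) (P : pred I) (F : I -> R[i]) :
  Normc.normc (\prod_(i <- r | P i) F i) =
  \prod_(i <- r | P i) Normc.normc (F i).
Proof.
by apply: (big_morph _ (@Normc.normcM R)); exact: Normc.normc1.
Qed.

Lemma le_normc_sum (I : Type) (r : seq I) (P : pred I) (F : I -> R[i]) :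
  Normc.normc (\sum_(i <- r | P i) F i) <=
  \sum_(i <- r | P i) Normc.normc (F i).
Proof.
elim/big_ind2: _ => [|x a y b xa yb|//]; first by rewrite Normc.normc0.
by apply: le_trans (le_normcD _ _) _; rewrite lerD.
Qed.

Lemma normcR (x : R) : 0 <= x -> Normc.normc x%:C%C = x.
Proof. by move=> x0; rewrite /= expr0n /= addr0 sqrtr_sqr ger0_norm. Qed.

Lemma sqr_normcE z : (Normc.normc z ^+ 2)%:C%C = z * z^*%C.
Proof. by rewrite rmorphXn -sqr_normc /=; case: z. Qed.

Lemma ler_Re_normc z : `|complex.Re z| <= Normc.normc z.
Proof.
by rewrite -lecR; apply: le_trans (normc_ge_Re z) _; case: z.
Qed.

Lemma ReD x y : complex.Re (x + y) = complex.Re x + complex.Re y.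
Proof. by case: x; case: y. Qed.

Lemma ReZ (a : R) z : complex.Re (a%:C%C * z) = a * complex.Re z.
Proof. by case: z => x y /=; rewrite mul0r subr0. Qed.

Lemma Re_sum (I : Type) (r : seq I) (P : pred I) (F : I -> R[i]) :
  complex.Re (\sum_(i <- r | P i) F i) = \sum_(i <- r | P i) complex.Re (F i).
Proof. by apply: (big_morph _ ReD). Qed.

(* On the unit circle [2 (1 + Re z) = (1 + z)^2 / z]. *)
Lemma unit_halfRe z n : Normc.normc z = 1 ->
  (((1 + complex.Re z) / 2) ^+ n)%:C%C = (1 + z) ^+ (2 * n) / (4 ^+ n * z ^+ n).
Proof.
move=> z1; have z0 : z != 0.
  by apply: contra_eq_neq z1 => ->; rewrite Normc.normc0 eq_sym oner_eq0.
rewrite rmorphXn /= exprM -exprMn -exprVn -exprMn; congr (_ ^+ n).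
have zz : z * z^*%C = 1 by rewrite -sqr_normcE z1 expr1n.
have -> : ((1 + complex.Re z) / 2)%:C%C = (1 + (z + z^-1) / 2) / 2 :> R[i].
  rewrite rmorphM rmorphD fmorphV rmorph_nat rmorph1 /= ReJ_add.
  by congr ((1 + (z + _) / _) / _); apply: (mulfI z0); rewrite zz mulfV.
by field; rewrite z0.
Qed.

End ComplexNorm.

Lemma exists_primitive_root (F : numClosedFieldType) n :
  (0 < n)%N -> exists z : F, n.-primitive_root z.
Proof.
move=> n_gt0; have [r] := closed_field_poly_normal ('X^n - 1 : {poly F}).
rewrite (monicP (monicXnsubC _ n_gt0)) scale1r => rE.
have /hasP[z _ zP] : has n.-primitive_root r; last by exists z.
apply: has_prim_root => //.
- by apply/allP => z; rewrite -root_prod_XsubC -rE.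
- by rewrite -separable_prod_XsubC -rE separable_Xn_sub_1 // pnatr_eq0 -lt0n.
by rewrite -ltnS -(size_prod_XsubC r id) -rE size_XnsubC.
Qed.

(** * Orthogonality relations for roots of unity *)

Section RootsOfUnity.
Context {F : fieldType} {l : nat} {z : F}.
Hypothesis zP : l.+1.-primitive_root z.

Lemma prim_root_neq0 : z != 0.
Proof.
apply/eqP => z0; have := prim_expr_order zP.
by rewrite z0 expr0n /= => /eqP; rewrite eq_sym oner_eq0.
Qed.

Lemma expr_ordD (a b : 'I_l.+1) : z ^+ (a + b)%R = z ^+ a * z ^+ b.
Proof. by rewrite -exprD /= (prim_expr_mod zP). Qed.

Lemma sum_prim_root (k : nat) :
  \sum_(a < l.+1) z ^+ a ^+ k = if (l.+1 %| k)%N then l.+1%:R else 0.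
Proof.
have z1 n : z ^+ (n * l.+1) = 1.
  by rewrite mulnC exprM (prim_expr_order zP) expr1n.
have [/dvdnP[c ->]|lk] := boolP (l.+1 %| k)%N.
  rewrite (eq_bigr (fun=> 1)) ?sumr_const ?card_ord // => a _.
  by rewrite -exprM mulnA z1.
have zk1 : z ^+ k - 1 != 0.
  by rewrite subr_eq0; apply: contra lk; rewrite (prim_order_dvd zP).
apply: (mulfI zk1); rewrite mulr0.
under eq_bigr do rewrite exprAC.
by rewrite -subrX1 exprAC (prim_expr_order zP) expr1n subrr.
Qed.

Lemma sum_prim_root_ratio (f M : nat) :
  \sum_(a < l.+1) z ^+ a ^+ f / z ^+ a ^+ M =
  if (f == M %[mod l.+1])%N then l.+1%:R else 0.
Proof.
have zn0 n : z ^+ n != 0 by rewrite expf_neq0 // prim_root_neq0.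
(* As [z ^+ l.+1 = 1], dividing by an [M]-th power is multiplying by an [l * M]-th power. *)
rewrite (eq_bigr (fun a : 'I__ => z ^+ a ^+ (f + l * M))); last first.
  move=> a _; apply: (mulIf (expf_neq0 M (zn0 a))).
  rewrite mulfVK ?(expf_neq0 M (zn0 a)) // -exprD -addnA -mulSnr exprD.
  by rewrite (exprM _ l.+1) (exprAC _ a l.+1) (prim_expr_order zP) !expr1n mulr1.
rewrite sum_prim_root; congr (if _ then _ else _).
have -> : (l.+1 %| f + l * M)%N = (f + l * M == 0 %[mod l.+1])%N.
  by rewrite mod0n.
by rewrite -(eqn_modDr M) add0n -addnA -mulSnr -modnDmr modnMr addn0.
Qed.

(** The bounds on [f] and [M] turn congruences modulo [l.+1] into equalities, so the finite torus
    extracts coefficients exactly. *)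
Lemma sum_torus (I : finType) (f M : I -> nat) :
  (forall j, f j < l.+1)%N -> (forall j, M j < l.+1)%N ->
  \sum_(a : {ffun I -> 'I_l.+1}) \prod_j (z ^+ a j ^+ f j / z ^+ a j ^+ M j) =
  if [forall j, f j == M j] then (l.+1 ^ #|I|)%:R else 0.
Proof.
move=> fl Ml; rewrite -(bigA_distr_bigA
  (fun j (a : 'I_l.+1) => z ^+ a ^+ f j / z ^+ a ^+ M j)) /=.
under eq_bigr do rewrite sum_prim_root_ratio !modn_small //.
case: ifPn => [/forallP fM|].
  by rewrite (eq_bigr (fun=> l.+1%:R)) ?prodr_const ?natrX // => j _; rewrite fM.
by rewrite negb_forall => /existsP[j /negPf fMj]; rewrite (bigD1 j) //= fMj mul0r.
Qed.

End RootsOfUnity.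

Section UnitCircle.
Context {R : rcfType} {l : nat} {z : R[i]}.
Hypothesis zP : l.+1.-primitive_root z.

Lemma normc_prim_root : Normc.normc z = 1.
Proof.
apply/eqP; rewrite -(eqrXn2 (ltn0Sn l)) ?ler01 ?normc_ge0 //.
by rewrite expr1n -normcX (prim_expr_order zP) Normc.normc1.
Qed.

(** By [unit_halfRe] the summand is a Laurent polynomial in [w * z ^+ b] with exponents between
    [- n] and [n]. As [n < l.+1], only its constant term survives, and the phase [w] disappears. *)
Lemma sum_halfRe (w : R[i]) n : Normc.normc w = 1 -> (n < l.+1)%N ->
  \sum_(b < l.+1) ((1 + complex.Re (w * z ^+ b)) / 2) ^+ n =
  l.+1%:R * ('C(2 * n, n)%:R / 4 ^+ n).
Proof.
move=> w1 nl; apply: complexI; rewrite rmorph_sum /=.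
have w0 : w != 0.
  by apply: contra_eq_neq w1 => ->; rewrite Normc.normc0 eq_sym oner_eq0.
have z0 := prim_root_neq0 zP.
transitivity (\sum_(b < l.+1) \sum_(i < (2 * n).+1)
  'C(2 * n, i)%:R * (w ^+ i / w ^+ n) / 4 ^+ n * (z ^+ b ^+ i / z ^+ b ^+ n)).
  apply: eq_bigr => b _.
  rewrite unit_halfRe; last first.
    by rewrite Normc.normcM normcX normc_prim_root w1 expr1n mulr1.
  rewrite exprDn mulr_suml; apply: eq_bigr => i _.
  rewrite expr1n mul1r -mulr_natl !exprMn invfM invfM.
  by ring.
rewrite exchange_big /= .
under eq_bigr => i _ do rewrite -mulr_sumr (sum_prim_root_ratio zP).
have ni : (n < (2 * n).+1)%N by lia.
rewrite (bigD1 (Ordinal ni)) //= eqxx big1 ?addr0 => [|i ini]; last first.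
  rewrite ifF ?mulr0 //; apply/negbTE.
  have {}ini : (i : nat) <> n by move=> e; case/eqP: ini; apply: val_inj.
  have := ltn_ord i; case: (ltnP n i) => h1 h2.
    rewrite eqn_mod_dvd; last exact: ltnW.
    by rewrite gtnNdvd //; lia.
  rewrite eq_sym eqn_mod_dvd // gtnNdvd //; lia.
rewrite mulfV ?expf_neq0 // mulr1 rmorphM fmorph_div /= rmorphXn !rmorph_nat /=.
by rewrite mulrC.
Qed.

End UnitCircle.

(** * Character sums on the discrete torus *)

Section CharacterSums.
Context {R : rcfType} {p l : nat} (Q : nat) (z : R[i]).
Hypotheses (pQ : (p * Q = l.+1)%N) (zP : l.+1.-primitive_root z).
Implicit Types (q : 'I_p -> R) (a : {ffun 'I_p -> 'I_l.+1}) (k : nat).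

(* [a : {ffun 'I_p -> 'I_l.+1}] stands for the point [(z ^+ a j)_j] of the
   torus. As [z ^+ Q] is a primitive [p]-th root of unity, the shift by
   [torus_shift k] multiplies its [j]-th coordinate by the value at [j] of the
   [k]-th additive character of [F_p]. *)
Definition torus_shift k : {ffun 'I_p -> 'I_l.+1} :=
  [ffun j : 'I_p => inZp (Q * j * k)].

Definition weighted_sum q a : R[i] := \sum_j (q j)%:C%C * z ^+ a j.

(** This is [F] of the opening sketch; the values of [weighted_sum] at the shifts of [a] are the
    [Z_k]. *)
Definition zero_sum_poly d q a : R[i] :=
  \sum_(x : {ffun 'I_d -> 'I_p} | (p %| \sum_i x i)%N)
    \prod_i ((q (x i))%:C%C * z ^+ a (x i)).

Let w := z ^+ Q.

Lemma prim_root_quot : p.-primitive_root w.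
Proof.
have p0 : (0 < p)%N by move: pQ; case: (p).
have -> : w = z ^+ (l.+1 %/ p) by rewrite -pQ mulKn.
by apply: dvdn_prim_root => //; rewrite -pQ dvdn_mulr.
Qed.

Lemma expr_shift a k (j : 'I_p) :
  z ^+ (a + torus_shift k)%R j = z ^+ a j * w ^+ (j * k).
Proof.
by rewrite !ffunE (expr_ordD zP) /= (prim_expr_mod zP) -mulnA exprM.
Qed.

(** Each monomial acquires the factor [w ^+ (k * \sum_i x i)], which is 1. This symmetry later
    reduces the [p] peaks to the one at [k = 0]. *)
Lemma zero_sum_poly_shift d q a k :
  zero_sum_poly d q (a + torus_shift k) = zero_sum_poly d q a.
Proof.
apply: eq_bigr => x /dvdnP[c xc].
under eq_bigr do rewrite expr_shift mulrA.
rewrite big_split /= prodrXr -[X in _ * X]/(_ ^+ _).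
rewrite -big_distrl /= xc -mulnA (mulnC p) mulnA mulnC exprM.
by rewrite (prim_expr_order prim_root_quot) expr1n mulr1.
Qed.

Lemma sum_weighted_sumX d q a :
  \sum_(k < p) weighted_sum q (a + torus_shift k) ^+ d =
  p%:R * zero_sum_poly d q a.
Proof.
transitivity (\sum_(k < p) \sum_(x : {ffun 'I_d -> 'I_p})
    \prod_i ((q (x i))%:C%C * z ^+ a (x i)) * w ^+ (\sum_i x i) ^+ k).
  apply: eq_bigr => k _; rewrite -[in LHS](card_ord d) -prodr_const.
  rewrite bigA_distr_bigA /=; apply: eq_bigr => x _.
  under eq_bigr do rewrite expr_shift mulrA.
  by rewrite big_split /= prodrXr -big_distrl /= exprM.
rewrite exchange_big mulr_sumr [RHS]big_mkcond /=; apply: eq_bigr => x _.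
rewrite -mulr_sumr.
have wP := prim_root_quot.
have -> : \sum_(k < p) w ^+ (\sum_i x i) ^+ k =
    if (p %| \sum_i x i)%N then p%:R else 0 :> R[i].
  rewrite (eq_bigr (fun k : 'I_p => w ^+ k ^+ (\sum_i x i))) => [|k _].
    move: wP; move: (\sum_i _)%N => s.
    by case: (p) => [|p'] wP; [have := prim_order_gt0 wP | exact: sum_prim_root].
  by rewrite exprAC.
by case: ifP; rewrite ?mulr0 // mulrC.
Qed.

(** For nearly uniform [q] the right-hand side is close to 1, so at most one shift can have modulus
    close to 1. *)
Lemma parseval q a :
  \sum_(k < p) Normc.normc (weighted_sum q (a + torus_shift k)) ^+ 2 =
  p%:R * \sum_j q j ^+ 2.
Proof.
apply: complexI; rewrite rmorph_sum /=.
have conjX n : (z ^+ n)^*%C = (z ^+ n)^-1.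
  have zn0 : z ^+ n != 0 by rewrite expf_neq0 // (prim_root_neq0 zP).
  apply: (mulfI zn0); rewrite mulfV // -sqr_normcE normcX (normc_prim_root zP).
  by rewrite !expr1n.
have conjcM (x y : R[i]) : (x * y)^*%C = x^*%C * y^*%C by rewrite rmorphM.
have w0 : w != 0 by rewrite expf_neq0 // (prim_root_neq0 zP).
transitivity (\sum_(k < p) \sum_i \sum_j (q i)%:C%C * (q j)%:C%C *
   (z ^+ a i / z ^+ a j) * (w ^+ k ^+ i / w ^+ k ^+ j)).
  apply: eq_bigr => k _; rewrite sqr_normcE rmorph_sum mulr_suml.
  apply: eq_bigr => i _.
  rewrite mulr_sumr; apply: eq_bigr => j _.
  rewrite -[X in _ * X]/((_ * _)^*%C) [X in _ * X]conjcM conjX conjc_real.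
  by rewrite !expr_shift -!(mulnC k) !exprM invfM; ring.
rewrite exchange_big rmorphM rmorph_sum rmorph_nat mulr_sumr /=.
apply: eq_bigr => i _; rewrite exchange_big (bigD1 i) //= [X in _ + X]big1 ?addr0.
  rewrite (eq_bigr (fun=> (q i)%:C%C * (q i)%:C%C)).
    by rewrite sumr_const card_ord expr2 rmorphM -[LHS]mulr_natl.
  by move=> k _; rewrite !mulfV ?mulr1 // ?expf_neq0 // (prim_root_neq0 zP).
move=> j ji; rewrite -mulr_sumr.
have -> : \sum_(k < p) w ^+ k ^+ i / w ^+ k ^+ j = 0; last by rewrite mulr0.
have := prim_root_quot; have := ltn_ord i; have := ltn_ord j.
have {ji} : (i != j :> nat)%N by rewrite eq_sym.
move: (i : nat) (j : nat) => i' j'; case: (p) => // p' ij jp ip wP.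
by rewrite (sum_prim_root_ratio wP) !modn_small // (negPf ij).
Qed.

Lemma normc_weighted_sum q a : (forall j, 0 <= q j) ->
  Normc.normc (weighted_sum q a) <= \sum_j q j.
Proof.
move=> q0; apply: le_trans (le_normc_sum _ _ _) _; apply: ler_sum => j _.
by rewrite Normc.normcM normcR // normcX (normc_prim_root zP) expr1n mulr1.
Qed.

End CharacterSums.

(** * The neighbourhood of a peak *)

Definition central_prob {R : realType} (n : nat) : R := 'C(2 * n, n)%:R / 4 ^+ n.

(** With [y = u + u ^+ 2], the intermediate quantity [(1 + y / 2) ^+ 2] is at most [expR y] and, for
    [u <= 1/4], at least the inverse of [1 - u]. *)
Lemma expR_sqr_le {R : realType} (u : R) :
  0 <= u -> u <= 1/4 -> expR (- (u + u ^+ 2)) <= 1 - u.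
Proof.
move=> u0 u4; have u1 : 0 < 1 - u by lra.
rewrite expRN -[leRHS]invrK lef_pV2 ?posrE ?expR_gt0 ?invr_gt0 //.
set y := u + u ^+ 2.
have y0 : 0 <= y by rewrite addr_ge0 // sqr_ge0.
apply: (@le_trans _ _ ((1 + y / 2) ^+ 2)); last first.
  have -> : expR y = expR (y / 2) ^+ 2 by rewrite -expRM_natr; congr expR; lra.
  by rewrite lerXn2r ?nnegrE ?expR_ge0 ?expR_ge1Dx //; lra.
rewrite -[leLHS]mul1r ler_pdivrMr //.
by rewrite /y; nra.
Qed.

Section NearPeak.
Context {R : realType} {p l : nat} (z : R[i]).
Hypothesis zP : l.+1.-primitive_root z.
Implicit Types (a : {ffun 'I_p -> 'I_l.+1}).

(* Its second order expansion at [1] is that of the product of the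
   [expR (M j * (Re (z ^+ a j) - 1))], but its averages over roots of unity are
   exact (see [sum_halfRe]). *)
Definition torus_bump (M : 'I_p -> nat) a : R :=
  \prod_j ((1 + complex.Re (z ^+ a j)) / 2) ^+ (2 * M j).

Lemma Re_prim_root_ge n : - 1 <= complex.Re (z ^+ n).
Proof.
rewrite lerNl; apply: le_trans (ler_norm _) _; rewrite normrN.
by apply: le_trans (ler_Re_normc _) _; rewrite normcX (normc_prim_root zP) expr1n.
Qed.

Lemma torus_bump_ge0 M a : 0 <= torus_bump M a.
Proof.
apply: prodr_ge0 => j _; apply: exprn_ge0.
by have := Re_prim_root_ge (a j); lra.
Qed.

Lemma sum_torus_bump M : (forall j, 2 * M j < l.+1)%N ->
  \sum_a torus_bump M a = l.+1%:R ^+ p * \prod_j central_prob (2 * M j).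
Proof.
move=> Ml; rewrite -(bigA_distr_bigA (fun j (b : 'I_l.+1) =>
  ((1 + complex.Re (z ^+ b)) / 2) ^+ (2 * M j))) /=.
have -> : l.+1%:R ^+ p = \prod_(j < p) l.+1%:R :> R by rewrite prodr_const card_ord.
rewrite -big_split /=; apply: eq_bigr => j _.
rewrite -(sum_halfRe zP (w := 1)) ?Normc.normc1 //.
by apply: eq_bigr => b _; rewrite mul1r.
Qed.

Let N M := (\sum_(j < p) M j)%N.

(* Only the rotations [b] with [1 - Re (w * z ^+ b) <= 2 * tau], for [w] the
   phase of the weighted sum, matter; the others are paid for by the term
   [expR (- (2 * N * tau))]. *)
Lemma peak_le_bump (M : 'I_p -> nat) (q : 'I_p -> R) a (m Lam tau : R) :
  (forall j, (M j)%:R = (N M)%:R * q j) ->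
  let s := Normc.normc (weighted_sum z q a) in
  0 < s -> s <= 1 -> 0 < m -> (forall j, m <= (M j)%:R) ->
  (2 * N M < l.+1)%N ->
  (N M)%:R * (1 - s) / 2 + (N M)%:R * tau <= Lam -> Lam / m <= 1/4 ->
  s ^+ N M * expR (- (2 * Lam ^+ 2 / m)) *
    (l.+1%:R * (central_prob (2 * N M) - expR (- (2 * (N M)%:R * tau))))
  <= \sum_(b < l.+1) torus_bump M (a + [ffun=> b]).
Proof.
move=> qM s s0 s1 m0 mM Nl sLam Lamm.
set n := N M in qM Nl sLam *.
pose Z := weighted_sum z q a; pose w := Z / s%:C%C.
have w1 : Normc.normc w = 1.
  by rewrite Normc.normcM Normc.normcV (normcR (ltW s0)) mulfV // gt_eqF.
have zb1 (k : nat) : Normc.normc (z ^+ k) = 1.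
  by rewrite normcX (normc_prim_root zP) expr1n.
rewrite /central_prob mulrBr -(sum_halfRe zP w1 Nl).
have -> : l.+1%:R * expR (- (2 * n%:R * tau)) =
   \sum_(b < l.+1) expR (- (2 * n%:R * tau)) by rewrite sumr_const card_ord mulr_natl.
rewrite -sumrB mulr_sumr; apply: ler_sum => b _.
set r := complex.Re (w * z ^+ b).
have [r1 rN1] : r <= 1 /\ - 1 <= r.
  have /ler_normlP[] : `|r| <= 1.
    by apply: le_trans (ler_Re_normc _) _; rewrite Normc.normcM w1 zb1 mulr1.
  by lra.
pose v := (1 - r) / 2.
have -> : (1 + r) / 2 = 1 - v by rewrite /v; lra.
have v0 : 0 <= v by rewrite /v; lra.
have v1 : v <= 1 by rewrite /v; lra.
have vexp : (1 - v) ^+ (2 * n) <= expR (- (2 * n%:R * v)).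
  have -> : - (2 * n%:R * v) = (- v) * (2 * n)%:R by rewrite natrM; ring.
  by rewrite expRM_natr lerXn2r ?nnegrE ?expR_ge0 ?expR_ge1Dx //; lra.
have sk0 : 0 <= s ^+ n * expR (- (2 * Lam ^+ 2 / m)).
  by rewrite mulr_ge0 ?expR_ge0 // exprn_ge0 // ltW.
have [vt|vt] := leP v tau; last first.
  apply: le_trans (torus_bump_ge0 _ _); rewrite mulr_ge0_le0 // subr_le0.
  apply: le_trans vexp _; rewrite ler_expR lerN2.
  by apply: ler_wpM2l; [rewrite mulr_ge0 | exact: ltW].
pose u j := (1 - complex.Re (z ^+ a j * z ^+ b)) / 2.
have Ru j : (1 + complex.Re (z ^+ (a + [ffun=> b])%R j)) / 2 = 1 - u j.
  by rewrite !ffunE (expr_ordD zP) /u; lra.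
have u0 j : 0 <= u j.
  suff : complex.Re (z ^+ a j * z ^+ b) <= 1 by rewrite /u; lra.
  apply: le_trans (ler_norm _) _; apply: le_trans (ler_Re_normc _) _.
  by rewrite Normc.normcM !zb1 mulr1.
have sumMq : \sum_j n%:R * q j = n%:R.
  by under eq_bigr do rewrite -qM; rewrite /n /N natr_sum.
have n0 : 0 <= n%:R :> R by [].
(* An exact identity: by the choice of the phase [w], the mean of [Re (z ^+ a j * z ^+ b)] with
   weights [q j] is [s * r]. *)
have sumMu : \sum_j (M j)%:R * u j = n%:R * (1 - s) / 2 + n%:R * (s * v).
  have -> : \sum_j (M j)%:R * u j =
      (\sum_j n%:R * q j - \sum_j n%:R * q j * complex.Re (z ^+ a j * z ^+ b)) / 2.
    rewrite -sumrB mulr_suml; apply: eq_bigr => j _; rewrite qM /u; lra.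
  rewrite sumMq.
  have -> : \sum_j n%:R * q j * complex.Re (z ^+ a j * z ^+ b) = n%:R * (s * r).
    have -> : s * r = complex.Re (Z * z ^+ b).
      rewrite -ReZ mulrA; congr (complex.Re (_ * _)).
      rewrite /w mulrCA mulfV ?mulr1 //.
      by rewrite -(rmorph0 (real_complex R)) (inj_eq (@complexI R)) gt_eqF.
    rewrite /Z /weighted_sum mulr_suml Re_sum mulr_sumr; apply: eq_bigr => j _.
    by rewrite -(mulrA (q j)%:C%C) ReZ mulrA.
  by rewrite /v; lra.
have sumLam : \sum_j (M j)%:R * u j <= Lam.
  rewrite sumMu; apply: le_trans sLam; rewrite lerD2l ler_wpM2l //.
  by apply: le_trans vt; rewrite ler_piMl // ltW.
(* Comparing a single term with the whole sum makes [expR_sqr_le] applicable and keeps the quadratic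
   terms small. *)
have uLam j : u j <= Lam / m.
  rewrite ler_pdivlMr //; apply: le_trans sumLam; rewrite (bigD1 j) //=.
  apply: (@le_trans _ _ ((M j)%:R * u j)); first by rewrite mulrC ler_wpM2r.
  by rewrite lerDl sumr_ge0 // => i _; rewrite mulr_ge0.
apply: (@le_trans _ _ (expR (- (\sum_j 2 * (M j)%:R * (u j + u j ^+ 2)))));
  last first.
  rewrite -sumrN expR_sum /torus_bump; apply: ler_prod => j _; rewrite expR_ge0 /=.
  have -> : - (2 * (M j)%:R * (u j + u j ^+ 2)) = - (u j + u j ^+ 2) * (2 * M j)%:R.
    by rewrite natrM; ring.
  have uj4 : u j <= 1/4 by apply: le_trans (uLam j) _.
  by rewrite Ru expRM_natr lerXn2r ?nnegrE ?expR_ge0 ?expR_sqr_le //; lra.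
have Lam0 : 0 <= Lam.
  by apply: le_trans sumLam; apply: sumr_ge0 => j _; rewrite mulr_ge0.
have sumMu2 : \sum_j 2 * (M j)%:R * (u j + u j ^+ 2) <=
    n%:R * (1 - s) + 2 * n%:R * v + 2 * Lam ^+ 2 / m.
  apply: (@le_trans _ _ (2 * (\sum_j (M j)%:R * u j) +
      2 * (Lam / m) * \sum_j (M j)%:R * u j)).
    rewrite !mulr_sumr -big_split /=; apply: ler_sum => j _.
    have -> : 2 * (M j)%:R * (u j + u j ^+ 2) =
      2 * ((M j)%:R * u j) + 2 * (u j) * ((M j)%:R * u j) by ring.
    by rewrite lerD2l; apply: ler_wpM2r; [exact: mulr_ge0 | exact: ler_wpM2l].
  apply: lerD.
    have : n%:R * (s * v) <= n%:R * v by rewrite ler_wpM2l // ler_piMl // ltW.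
    by rewrite sumMu; lra.
  apply: (@le_trans _ _ (2 * (Lam / m) * Lam)).
    by rewrite ler_wpM2l // mulr_ge0 // divr_ge0 // ltW.
  by rewrite expr2 -!mulrA (mulrC m^-1).
apply: (@le_trans _ _ (s ^+ n * expR (- (2 * Lam ^+ 2 / m)) * (1 - v) ^+ (2 * n))).
  by rewrite ler_wpM2l // gerBl expR_ge0.
apply: (@le_trans _ _
  (expR (- (n%:R * (1 - s) + 2 * n%:R * v + 2 * Lam ^+ 2 / m)))); last first.
  by rewrite ler_expR lerN2.
(* The first order terms match: [s <= expR (s - 1)] accounts for [n * (1 - s)], and [vexp] for
   [2 * n * v]. *)
rewrite !opprD !expRD mulrAC; apply: ler_wpM2r; first exact: expR_ge0.
apply: ler_pM => //; first by rewrite exprn_ge0 // ltW.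
  by rewrite exprn_ge0 //; lra.
rewrite -mulrN mulrC expRM_natr lerXn2r ?nnegrE ?expR_ge0 ?(ltW s0) //.
by have := expR_ge1Dx (s - 1); rewrite addrC subrK opprB.
Qed.

End NearPeak.

(** * The average of the powers of the generating polynomial *)

Section FourierBound.
Context {R : realType} {p l Q : nat} {z : R[i]}.
Hypotheses (pQ : (p * Q = l.+1)%N) (zP : l.+1.-primitive_root z).
Context {d n : nat} {m : 'I_p -> nat}.
Hypotheses (d3 : (3 <= d)%N) (n0 : (0 < n)%N) (mn : (\sum_j m j)%N = n).
Hypothesis (nl : (4 * (d * n) < l.+1)%N).
(** [eta] is the threshold for being near a peak, [beta] controls the deviation of [q] from
    uniformity, [tau] is the window of rotations, and [mu] bounds the target counts [d * m j] from
    below. *)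
Context {eta beta tau mu : R}.
Let q (j : 'I_p) : R := (m j)%:R / n%:R.
Let N := (d * n)%N.
Let Lam := N%:R * eta / 2 + N%:R * tau.
Hypotheses (q2 : p%:R * \sum_j q j ^+ 2 <= 1 + beta) (beta0 : 0 <= beta).
Hypotheses (eta0 : 0 <= eta) (eta1 : eta + beta <= 1) (deta : d%:R * eta <= 1/2).
Hypotheses (mu0 : 0 < mu) (muM : forall j, mu <= (d * m j)%:R).
Hypothesis (Lmu : Lam / mu <= 1/4).
Hypothesis (tau0 : expR (- (2 * N%:R * tau)) < central_prob (2 * N) :> R).

Let s (k : nat) (a : {ffun 'I_p -> 'I_l.+1}) :=
  Normc.normc (weighted_sum z q (a + torus_shift Q k)).
Let A (a : {ffun 'I_p -> 'I_l.+1}) := Normc.normc (p%:R * zero_sum_poly z d q a).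

Let nR0 : 0 < n%:R :> R. Proof. by rewrite ltr0n. Qed.

Let q0 j : 0 <= q j. Proof. by rewrite divr_ge0. Qed.

Let sum_q : \sum_j q j = 1.
Proof. by rewrite -mulr_suml -natr_sum mn mulfV // gt_eqF. Qed.

Let s0 k a : 0 <= s k a. Proof. exact: normc_ge0. Qed.

Let s1 k a : s k a <= 1.
Proof. by rewrite -sum_q; apply: normc_weighted_sum. Qed.

Let sum_s2 a : \sum_(k < p) s k a ^+ 2 <= 1 + beta.
Proof. by rewrite (parseval pQ zP). Qed.

Let A_le a : A a <= \sum_(k < p) s k a ^+ d.
Proof.
rewrite /A -(sum_weighted_sumX pQ zP); apply: le_trans (le_normc_sum _ _ _) _.
by apply: ler_sum => k _; rewrite normcX.
Qed.

Let shift0 a : a + torus_shift (l := l) (p := p) Q 0 = a.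
Proof.
apply/ffunP => j; rewrite !ffunE muln0; apply: val_inj.
by rewrite /= mod0n addn0 modn_small.
Qed.

(** Each [s k a] is at most [expR (- (eta / 2))]. As [d >= 3], one factor can be spent on this bound
    and two on the sum of squares. *)
Let A_far a : (forall k : 'I_p, s k a ^+ 2 < 1 - eta) ->
  A a <= expR (- (eta / 2 - beta)).
Proof.
move=> far; apply: le_trans (A_le a) _.
have se (k : 'I_p) : s k a <= expR (- (eta / 2)).
  rewrite -(@ler_pXn2r _ 2) ?nnegrE ?expR_ge0 //.
  rewrite -expRM_natr; apply: le_trans (ltW (far k)) _.
  by apply: le_trans (expR_ge1Dx _) _; rewrite ler_expR; lra.
apply: (@le_trans _ _ (expR (- (eta / 2)) * \sum_(k < p) s k a ^+ 2)).
  rewrite mulr_sumr; apply: ler_sum => k _.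
  apply: (@le_trans _ _ (s k a ^+ 3)); first by rewrite ler_wiXn2l.
  by rewrite exprS ler_wpM2r ?exprn_ge0.
have -> : - (eta / 2 - beta) = - (eta / 2) + beta by lra.
rewrite expRD ler_wpM2l ?expR_ge0 //; apply: le_trans (sum_s2 a) _.
exact: expR_ge1Dx.
Qed.

Let rest := (eta + beta) * Num.sqrt (eta + beta).

Let p0 : (0 < p)%N. Proof. by move: pQ; case: (p). Qed.

(** The squares with [k != 0] sum to at most [eta + beta], so each such [s k a] is at most
    [Num.sqrt (eta + beta)] and the cubes sum to at most [rest]. As [s 0 a ^+ d >= 1/2], this
    additive error becomes a factor [1 + 2 * rest]. *)
Let A_near a : 1 - eta <= s 0 a ^+ 2 ->
  A a ^+ n <= s 0 a ^+ N * expR (2 * n%:R * rest).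
Proof.
move=> near0.
have [eta0' beta0' eta1' deta'] := And4 eta0 beta0 eta1 deta.
have eb0 : 0 <= eta + beta by rewrite addr_ge0.
have rest0 : 0 <= rest by rewrite mulr_ge0 ?sqrtr_ge0.
have sd2 : 1/2 <= s 0 a ^+ d.
  apply: (@le_trans _ _ ((1 - eta) ^+ d)); last first.
    have e1 : 0 <= 1 - eta by lra.
    rewrite lerXn2r ?nnegrE //.
    by apply: le_trans near0 _; rewrite expr2 ler_piMr.
  apply: (@le_trans _ _ (1 - d%:R * eta)); first by lra.
  have e1 : eta <= 1 by lra.
  elim: (d) => [|k IH]; first by rewrite mul0r subr0 expr0.
  rewrite exprS -natr1; apply: (@le_trans _ _ ((1 - eta) * (1 - k%:R * eta))).
    by have := mulr_ge0 (ler0n R k) (mulr_ge0 eta0 eta0); nra.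
  by rewrite ler_wpM2l //; lra.
have A_le' : A a <= s 0 a ^+ d + rest.
  apply: le_trans (A_le a) _; rewrite (bigD1 (Ordinal p0)) //= lerD2l.
  have rest2 : \sum_(k < p | k != Ordinal p0) s k a ^+ 2 <= eta + beta.
    by have := sum_s2 a; rewrite (bigD1 (Ordinal p0)) //=; lra.
  apply: (@le_trans _ _ (Num.sqrt (eta + beta) *
      \sum_(k < p | k != Ordinal p0) s k a ^+ 2)); last first.
    by rewrite /rest mulrC ler_wpM2r ?sqrtr_ge0.
  rewrite mulr_sumr; apply: ler_sum => k k0.
  apply: (@le_trans _ _ (s k a ^+ 3)); first by rewrite ler_wiXn2l.
  rewrite exprS ler_wpM2r ?exprn_ge0 //.
  rewrite -(@ler_pXn2r _ 2) ?nnegrE ?sqrtr_ge0 // sqr_sqrtr //.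
  apply: le_trans rest2; rewrite (bigD1 k) //= lerDl.
  by apply: sumr_ge0 => i _; rewrite exprn_ge0.
have -> : 2 * n%:R * rest = (2 * rest) * n%:R by ring.
rewrite expRM_natr /N exprM -exprMn.
rewrite lerXn2r ?nnegrE ?normc_ge0 ?mulr_ge0 ?expR_ge0 ?exprn_ge0 //.
apply: le_trans A_le' _.
apply: (@le_trans _ _ (s 0 a ^+ d * (1 + 2 * rest))).
  by have := ler_wpM2r rest0 sd2; lra.
by rewrite ler_wpM2l ?exprn_ge0 ?expR_ge1Dx.
Qed.

(** The two losses at a peak: [rest] from the other shifts, [Lam ^+ 2 / mu] from the second order
    terms in [peak_le_bump]. *)
Let K := expR (2 * n%:R * rest + 2 * Lam ^+ 2 / mu).

Let Mn : (\sum_(j < p) d * m j)%N = N. Proof. by rewrite -big_distrr /= mn. Qed.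

Let Gap : R := central_prob (2 * N) - expR (- (2 * N%:R * tau)).

Let near_bump a : 1 - eta <= s 0 a ^+ 2 ->
  A a ^+ n * (l.+1%:R * Gap) <=
  K * \sum_(b < l.+1) torus_bump z (fun j => d * m j)%N (a + [ffun=> b]).
Proof.
move=> near0; rewrite /K addrC expRD.
have [eta0' deta'] := conj eta0 deta.
have sE : s 0 a = Normc.normc (weighted_sum z q a) by rewrite /s shift0.
have seta : eta <= 1/2.
  apply: le_trans deta; rewrite ler_peMl // ler1n; lia.
have sa0 : 0 < Normc.normc (weighted_sum z q a).
  rewrite -sE lt_neqAle s0 andbT; apply/eqP => sa0.
  by move: near0; rewrite -sa0 expr0n /=; lra.
have := @peak_le_bump R p l z zP (fun j => d * m j)%N q a mu Lam tau.
rewrite Mn -sE => peak.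
have {peak} peak : s 0 a ^+ N * expR (- (2 * Lam ^+ 2 / mu)) * (l.+1%:R * Gap) <=
    \sum_(b < l.+1) torus_bump z (fun j => d * m j)%N (a + [ffun=> b]).
  apply: peak => //.
  - by move=> j; rewrite /q !natrM mulrAC mulrA mulfVK // gt_eqF.
  - by rewrite sE.
  - by rewrite /N; lia.
  rewrite -/Lam lerD2r ler_pM2r ?invr_gt0 //; apply: ler_wpM2l => //.
  have : s 0 a ^+ 2 <= s 0 a by rewrite expr2 ler_piMr.
  by lra.
have GL0 : 0 <= l.+1%:R * Gap by rewrite mulr_ge0 // subr_ge0 ltW.
apply: (@le_trans _ _ (s 0 a ^+ N * expR (2 * n%:R * rest) * (l.+1%:R * Gap))).
  by apply: ler_wpM2r => //; exact: A_near.
apply: le_trans (ler_wpM2l _ peak); last by rewrite mulr_ge0 ?expR_ge0.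
rewrite expRN; set E := expR (2 * Lam ^+ 2 / mu); set E' := expR (_ * rest).
have E0 : E != 0 by rewrite gt_eqF ?expR_gt0.
by rewrite le_eqVlt; apply/orP; left; apply/eqP; field.
Qed.

Lemma sum_zero_sum_poly_le :
  \sum_(a : {ffun 'I_p -> 'I_l.+1})
     Normc.normc (p%:R * zero_sum_poly z d q a) ^+ n <=
  l.+1%:R ^+ p * (expR (- (n%:R * (eta / 2 - beta))) +
    p%:R * K * (\prod_j central_prob (2 * (d * m j))) / Gap).
Proof.
have Gap0 : 0 < Gap by rewrite subr_gt0.
have L0 : 0 < l.+1%:R :> R by rewrite ltr0n.
have A0 a : 0 <= A a by exact: normc_ge0.
(* If no shift is near a peak, the first term suffices; otherwise the summand of one such [k]
   does. *)
have split_le a : A a ^+ n <= expR (- (n%:R * (eta / 2 - beta))) +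
    \sum_(k < p) (if 1 - eta <= s k a ^+ 2 then A a ^+ n else 0).
  have rest_ge0 (P : pred 'I_p) :
      0 <= \sum_(k < p | P k) (if 1 - eta <= s k a ^+ 2 then A a ^+ n else 0).
    by apply: sumr_ge0 => k _; case: ifP => // _; rewrite exprn_ge0.
  have [/existsP[k near]|] := boolP [exists k : 'I_p, 1 - eta <= s k a ^+ 2].
    by rewrite (bigD1 k) //= near addrCA lerDl addr_ge0 ?expR_ge0.
  rewrite negb_exists => /forallP far; apply: ler_wpDr => //.
  rewrite mulrC -mulNr expRM_natr lerXn2r ?nnegrE ?expR_ge0 //.
  by apply: A_far => k; rewrite ltNge.
apply: le_trans (ler_sum _ (fun a _ => split_le a)) _.
rewrite big_split /= sumr_const (mulrDr (l.+1%:R ^+ p)) card_ffun !card_ord.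
rewrite -[X in X + _ <= _]mulr_natl natrX lerD2l exchange_big /=.
pose g a : R := if 1 - eta <= s 0 a ^+ 2 then A a ^+ n else 0.
(* Translating the torus by [torus_shift Q k] carries peak [k] to peak 0 and preserves [A]. *)
rewrite (eq_bigr (fun=> \sum_a g a)); last first.
  move=> k _; rewrite [RHS](reindex_inj (addIr (torus_shift Q k))) /=.
  by apply: eq_bigr => a _; rewrite /g /A (zero_sum_poly_shift pQ zP) /s shift0.
rewrite sumr_const card_ord -[leLHS]mulr_natl.
have -> (x y t u v : R) : t * (x * y * u / v) = x * (t * (y * u / v)) by ring.
apply: ler_wpM2l => //.
apply: (@le_trans _ _ (\sum_(a : {ffun 'I_p -> 'I_l.+1}) K / (l.+1%:R * Gap) *
    \sum_(b < l.+1) torus_bump z (fun j => d * m j)%N (a + [ffun=> b]))).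
  apply: ler_sum => a _; rewrite mulrAC ler_pdivlMr ?mulr_gt0 // /g.
  case: ifP => [|_]; first exact: near_bump.
  by rewrite mul0r mulr_ge0 ?expR_ge0 // sumr_ge0 // => b _; exact: torus_bump_ge0.
rewrite -mulr_sumr exchange_big /=.
rewrite (eq_bigr (fun=> \sum_(a : {ffun 'I_p -> 'I_l.+1})
  torus_bump z (fun j => d * m j)%N a)); last first.
  by move=> b _; rewrite [RHS](reindex_inj (addIr [ffun=> b])).
rewrite sumr_const card_ord -[X in _ * X <= _]mulr_natl (sum_torus_bump zP); last first.
  move=> j; apply: leq_ltn_trans nl; rewrite -/N -Mn leq_mul //.
  by rewrite (bigD1 j) //= leq_addr.
rewrite le_eqVlt; apply/orP; left; apply/eqP; field.
by rewrite !gt_eqF.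
Qed.

End FourierBound.

(** * From probabilities to character sums *)

Section Types.
Context {d p : nat}.
Implicit Types (y : {ffun 'I_d -> 'I_p}).

(** The analogue of [Phi] for entries in ['I_p] instead of ['F_p]; [big_U] makes the transfer. *)
Definition type_of y : {ffun 'I_p -> nat} :=
  [ffun j => #|[set i | y i == j]%SET|].

Lemma prod_type_of (F : comNzRingType) y (g : 'I_p -> F) :
  \prod_i g (y i) = \prod_j g j ^+ type_of y j.
Proof.
rewrite (partition_big y predT) //=; apply: eq_bigr => j _.
rewrite (eq_bigr (fun=> g j)); last by move=> i /eqP ->.
by rewrite prodr_const ffunE; congr (_ ^+ _); apply: eq_card => i; rewrite !inE.
Qed.

Lemma sum_type_of y (g : 'I_p -> nat) :
  (\sum_i g (y i) = \sum_j type_of y j * g j)%N.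
Proof.
rewrite (partition_big y predT) //=; apply: eq_bigr => j _.
rewrite (eq_bigr (fun=> g j)); last by move=> i /eqP ->.
rewrite sum_nat_const ffunE; congr (_ * _)%N.
by apply: eq_card => i; rewrite !inE.
Qed.

Lemma type_of_le y j : (type_of y j <= d)%N.
Proof. by rewrite ffunE (leq_trans (max_card _)) // card_ord. Qed.

Lemma big_U (V : nmodType) (g : {ffun 'I_p -> nat} -> V) : prime p ->
  \sum_(u <- U d p) g u =
  \sum_(y : {ffun 'I_d -> 'I_p} | (p %| \sum_i y i)%N) g (type_of y).
Proof.
move=> p_pr; rewrite big_map big_filter big_enum_cond /=.
pose h (y : {ffun 'I_d -> 'I_p}) : 'rV['F_p]_d :=
  \row_i cast_ord (esym (Fp_cast p_pr)) (y i).
pose h' (x : 'rV['F_p]_d) : {ffun 'I_d -> 'I_p} :=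
  [ffun i => cast_ord (Fp_cast p_pr) (x 0 i)].
rewrite (reindex h) /=; last first.
  exists h' => [y _|x _].
    by apply/ffunP => i; rewrite !ffunE mxE; apply: val_inj.
  by apply/rowP => i; rewrite !mxE !ffunE; apply: val_inj.
apply: eq_big => [y|y _].
  have vE i : h y 0 i = (y i)%:R.
    by rewrite mxE; apply: val_inj; rewrite /= val_Fp_nat // modn_small.
  rewrite (eq_bigr (fun i => (y i)%:R)) // -natr_sum.
  by rewrite -(dvdn_pcharf (pchar_Fp p_pr)).
congr g; apply/ffunP => j; rewrite !ffunE; apply: eq_card => i.
by rewrite !inE mxE /=.
Qed.

(** No type has an entry above [d], so for [d <= B] the sum over [v] meets every element of
    [U d p]. *)
Lemma sum_count_U (F : comNzRingType) B (g : {ffun 'I_p -> nat} -> F) :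
  prime p -> (d <= B)%N ->
  \sum_(v : {ffun 'I_p -> 'I_B.+1})
    (count_mem [ffun j => v j : nat] (U d p))%:R * g [ffun j => v j : nat] =
  \sum_(y : {ffun 'I_d -> 'I_p} | (p %| \sum_i y i)%N) g (type_of y).
Proof.
move=> p_pr dB.
transitivity (\sum_(v : {ffun 'I_p -> 'I_B.+1})
    \sum_(y : {ffun 'I_d -> 'I_p} | (p %| \sum_i y i)%N)
      if type_of y == [ffun j => v j : nat] then g (type_of y) else 0).
  apply: eq_bigr => v _; rewrite -sum1_count natr_sum mulr_suml big_mkcond /=.
  rewrite -(big_U (fun u => if u == [ffun j => v j : nat] then g u else 0)) //.
  by apply: eq_bigr => u _; case: eqP => // ->; rewrite mul1r.
rewrite exchange_big /=; apply: eq_bigr => y _.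
rewrite -big_mkcond (big_pred1 [ffun j => inord (type_of y j)]) //= => v.
have yB j : (type_of y j < B.+1)%N by rewrite ltnS (leq_trans (type_of_le y j)).
apply/eqP/eqP => [e|->].
  apply/ffunP => j; apply: val_inj.
  by rewrite [X in _ = nat_of_ord X]ffunE /= inordK // e ffunE.
by apply/ffunP => j; rewrite [RHS]ffunE [X in _ = nat_of_ord X]ffunE inordK.
Qed.

End Types.

(** Summing over all characters detects divisibility by [p]; a nontrivial character sums to 0 over
    each coordinate, which leaves [p ^ d]. *)
Lemma card_zero_sum (p d : nat) : (0 < p)%N -> (0 < d)%N ->
  (p * #|[pred y : {ffun 'I_d -> 'I_p} | p %| \sum_i y i]| = p ^ d)%N.
Proof.
case: p d => // p [] // d _ _.
have [z zP] := @exists_primitive_root algC p.+1 isT.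
apply/eqP; rewrite -(eqr_nat algC) natrM -sum1_card natr_sum; apply/eqP.
transitivity (\sum_(k < p.+1) \prod_(i < d.+1) \sum_(j < p.+1) z ^+ j ^+ k : algC).
  under [RHS]eq_bigr do rewrite bigA_distr_bigA /=.
  rewrite exchange_big /= mulr_sumr [LHS]big_mkcond /=; apply: eq_bigr => y _.
  under [RHS]eq_bigr do rewrite prodrXl prodrXr.
  under [RHS]eq_bigr do rewrite exprAC.
  by rewrite (sum_prim_root zP) inE; case: ifP; rewrite ?mulr1.
rewrite (bigD1 ord0) //= [X in _ + X]big1 ?addr0 => [|k k0].
  by rewrite prodr_const card_ord (sum_prim_root zP) dvdn0 natrX.
rewrite prodr_const card_ord (sum_prim_root zP) ifF ?expr0n //.
by rewrite gtnNdvd // lt0n.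
Qed.

(** For [B] large enough, the number of [n]-tuples of zero-sum vectors with joint type [M], grouped
    by the types of the single vectors. *)
Definition word_count (d n B p : nat) (M : 'I_p -> nat) : nat :=
  (\sum_(f : {ffun 'I_n -> {ffun 'I_p -> 'I_B.+1}} |
      [forall j, \sum_i f i j == M j])
    \prod_i count_mem [ffun j => f i j : nat] (U d p))%N.

Section Words.
Context {R : realType} {p l Q d n B : nat} {z : R[i]}.
Hypotheses (pQ : (p * Q = l.+1)%N) (zP : l.+1.-primitive_root z).
Hypotheses (p_pr : prime p) (dB : (d <= B)%N) (nBl : (n * B < l.+1)%N).
Variables (M : 'I_p -> nat).
Hypothesis Ml : forall j, (M j < l.+1)%N.

Let count_type (v : {ffun 'I_p -> 'I_B.+1}) : nat :=
  count_mem [ffun j => v j : nat] (U d p).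

(** Coefficient extraction from the [n]-th power by [sum_torus]. Only the exponent [M] survives, so
    the weights [q] contribute a constant; [n * B < l.+1] prevents exponents from wrapping
    around. *)
Lemma word_count_fourier (q : 'I_p -> R) :
  ((word_count d n B M)%:R * \prod_j q j ^+ M j * l.+1%:R ^+ p)%:C%C =
  \sum_(a : {ffun 'I_p -> 'I_l.+1})
    zero_sum_poly z d q a ^+ n / \prod_j z ^+ a j ^+ M j.
Proof.
pose h (a : {ffun 'I_p -> 'I_l.+1}) (u : {ffun 'I_p -> nat}) : R[i] :=
  \prod_j ((q j)%:C%C * z ^+ a j) ^+ u j.
have polyE a : zero_sum_poly z d q a = \sum_(v : {ffun 'I_p -> 'I_B.+1})
    (count_type v)%:R * h a [ffun j => v j : nat].
  rewrite sum_count_U //; apply: eq_bigr => y _.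
  exact: (prod_type_of y (fun j => (q j)%:C%C * z ^+ a j)).
pose S (f : {ffun 'I_n -> {ffun 'I_p -> 'I_B.+1}}) j := (\sum_i f i j)%N.
have Sl f j : (S f j < l.+1)%N.
  apply: leq_ltn_trans nBl; rewrite -[in leqRHS](card_ord n) -sum_nat_const.
  by apply: leq_sum => i _; rewrite -ltnS.
transitivity (\sum_(a : {ffun 'I_p -> 'I_l.+1})
  \sum_(f : {ffun 'I_n -> {ffun 'I_p -> 'I_B.+1}})
    (\prod_i (count_type (f i))%:R) * (\prod_j (q j)%:C%C ^+ S f j) *
    \prod_j (z ^+ a j ^+ S f j / z ^+ a j ^+ M j)); last first.
  apply: eq_bigr => a _; rewrite polyE -[in RHS](card_ord n) -prodr_const.
  rewrite bigA_distr_bigA /= mulr_suml; apply: eq_bigr => f _.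
  have hE : \prod_i h a [ffun j => f i j : nat] =
      (\prod_j (q j)%:C%C ^+ S f j) * \prod_j z ^+ a j ^+ S f j.
    rewrite exchange_big -big_split /=; apply: eq_bigr => j _.
    by under eq_bigr do rewrite ffunE; rewrite prodrXr -exprMn.
  by rewrite big_split [in RHS]big_split /= hE prodfV !mulrA.
rewrite exchange_big /=.
transitivity (\sum_(f : {ffun 'I_n -> {ffun 'I_p -> 'I_B.+1}})
    (\prod_i (count_type (f i))%:R) * (\prod_j (q j)%:C%C ^+ S f j) *
    if [forall j, S f j == M j] then (l.+1 ^ #|'I_p|)%:R else 0); last first.
  by apply: eq_bigr => f _; rewrite -(sum_torus zP (Sl f) Ml) -mulr_sumr.
rewrite !rmorphM /= rmorph_nat rmorph_prod rmorphXn rmorph_nat /=.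
rewrite /word_count natr_sum !mulr_suml [LHS]big_mkcond /=; apply: eq_bigr => f _.
have -> : [forall j, S f j == M j] = [forall j, \sum_i f i j == M j]%N by [].
case: ifPn => [/forallP SM|_]; last by rewrite mulr0.
rewrite natr_prod card_ord natrX; congr (_ * _ * _).
by apply: eq_bigr => j _; rewrite rmorphXn /= /S (eqP (SM j)).
Qed.

End Words.

Lemma size_U (d p : nat) : prime p -> (0 < d)%N -> size (U d p) = (p ^ (d - 1))%N.
Proof.
move=> p_pr d0; have p0 := prime_gt0 p_pr.
apply/eqP; rewrite -(eqn_pmul2l p0) -expnS subn1 prednK // -(card_zero_sum p0 d0).
by rewrite -sum1_size -sum1_card (big_U (fun=> 1%N)).
Qed.

Lemma count_mem_U (d p : nat) (v : {ffun 'I_p -> nat}) : prime p ->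
  count_mem v (U d p) =
  (\sum_(y : {ffun 'I_d -> 'I_p} | (p %| \sum_i y i)%N) (type_of y == v))%N.
Proof.
move=> p_pr; rewrite -sum1_count big_mkcond /=.
by rewrite (big_U (fun u => nat_of_bool (u == v))).
Qed.

(** A zero-sum vector [y] has [\sum_j type_of y j * j] divisible by [p]; adding over the [n] vectors
    gives the same for [M]. *)
Lemma word_count_eq0 (d n B p : nat) (M : 'I_p -> nat) : prime p ->
  ~~ (p %| \sum_j M j * j)%N -> word_count d n B M = 0%N.
Proof.
move=> p_pr pM; apply/eqP; rewrite sum_nat_eq0; apply/forallP => f; apply/implyP.
move=> /forallP fM; apply: contraR pM => f0.
rewrite (eq_bigr (fun j => \sum_i f i j * j)%N); last first.
  by move=> j _; rewrite -(eqP (fM j)) big_distrl.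
rewrite exchange_big /=; apply: dvdn_sum => i _.
have : count_mem [ffun j => f i j : nat] (U d p) != 0%N.
  by apply: contra f0 => /eqP fi0; rewrite (bigD1 i) //= fi0.
rewrite count_mem_U // sum_nat_eq0 negb_forall => /existsP[y].
rewrite negb_imply eqb0 negbK => /andP[py /eqP yE].
have -> : (\sum_(j < p) f i j * j = \sum_j type_of y j * j)%N.
  by apply: eq_bigr => j _; rewrite yE ffunE.
by rewrite -(sum_type_of y (fun j => j)).
Qed.

(** * From the law of the sum to the count of words *)

Section Probability.
Context {disp : measure_display} {T : measurableType disp} {R : realType}.
Context (P : probability T R) {d n p : nat}.
Variable X : 'I_n -> T -> {ffun 'I_p -> nat}.
Hypotheses (Xm : forall i, discrete_rv (X i)).
Hypotheses (Xu : forall i, uniform_over P (U d p) (X i)).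
Hypothesis Xi : mutually_independent P X.

Lemma Boole_fin (I : Type) (r : seq I) (S : pred I) (A : I -> set T) :
  (forall i, measurable (A i)) ->
  (P (\big[setU/set0]_(i <- r | S i) A i) <= \sum_(i <- r | S i) P (A i))%E.
Proof.
move=> mA; elim: r => [|i r IH]; first by rewrite !big_nil measure0.
rewrite !big_cons; case: ifP => // _.
apply: le_trans (measureU2 _ _ _) _ => //; last exact: leeD2l.
by apply: bigsetU_measurable.
Qed.

(** Since [M j <= B], the event is a union over sequences of values bounded by [B]. Independence
    evaluates each member, and the union bound adds them up. *)
Lemma prob_sum_eq_le B (M : 'I_p -> nat) : (forall j, M j <= B)%N ->
  fine (P [set w | forall j : 'I_p, (\sum_(i < n) X i w j = M j)%N]) <=
  (word_count d n B M)%:R / (size (U d p))%:R ^+ n.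
Proof.
move=> MB; pose V := {ffun 'I_p -> 'I_B.+1}.
pose v_ (v : V) : {ffun 'I_p -> nat} := [ffun j => v j : nat].
pose A (f : {ffun 'I_n -> V}) : set T :=
  \bigcap_(i in [set` [set: 'I_n]%SET]) (X i @^-1` [set u | u = v_ (f i)]).
pose S (f : {ffun 'I_n -> V}) := [forall j, (\sum_i f i j == M j)%N].
have mA f : measurable (A f).
  apply: fin_bigcap_measurable => [|i _]; first exact: finite_finset.
  exact: Xm.
have PA f : P (A f) =
    (\prod_i ((count_mem (v_ (f i)) (U d p))%:R / (size (U d p))%:R))%:E.
  rewrite /A (Xi [set: 'I_n]%SET (fun i => [set u | u = v_ (f i)])).
  rewrite -prodEFin; apply: eq_big => [i|i _]; first by rewrite inE.
  exact: Xu.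
have sumE : [set w | forall j : 'I_p, (\sum_(i < n) X i w j = M j)%N] =
    \big[setU/set0]_(f : {ffun 'I_n -> V} | S f) A f.
  rewrite -bigcup_seq_cond; apply/seteqP.
  split => [w /= wM|w [f /= /andP[_ /forallP fM] wf] j].
    have XB i j : (X i w j < B.+1)%N.
      by rewrite ltnS (leq_trans _ (MB j)) // -wM (bigD1 i) //= leq_addr.
    exists [ffun i => [ffun j => inord (X i w j)]] => /=.
      rewrite mem_index_enum /=; apply/forallP => j; rewrite -wM; apply/eqP.
      by apply: eq_bigr => i _; rewrite !ffunE inordK.
    by move=> i _ /=; apply/ffunP => j; rewrite !ffunE inordK.
  rewrite -(eqP (fM j)); apply: eq_bigr => i _.
  have iT : [set` [set: 'I_n]%SET] i by rewrite /= inE.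
  by have /= -> := wf i iT; rewrite ffunE.
rewrite -lee_fin fineK; last first.
  by apply: fin_num_measure; rewrite sumE; apply: bigsetU_measurable.
rewrite sumE; apply: le_trans (Boole_fin _ _ mA) _.
under eq_bigr do rewrite PA.
rewrite sumEFin lee_fin /word_count natr_sum mulr_suml le_eqVlt; apply/orP; left.
apply/eqP; apply: eq_bigr => f _; rewrite natr_prod -exprVn.
by rewrite big_split /= prodr_const card_ord.
Qed.

End Probability.

(** Multinomial coefficients count words of given type. Induction by removing the first letter [k]:
    this lowers [m k] by one, and the [m k] sum to the length of the word. *)
Lemma card_type_of (p n : nat) (m : 'I_p -> nat) : (\sum_j m j)%N = n ->
  ((\prod_j (m j)`!) *
   (\sum_(y : {ffun 'I_n -> 'I_p}) [forall j, type_of y j == m j]) = n`!)%N.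
Proof.
have typeE k (y : {ffun 'I_k -> 'I_p}) j : (type_of y j = \sum_i (y i == j))%N.
  rewrite ffunE -sum1_card big_mkcond; apply: eq_bigr => i _.
  by rewrite inE; case: eqP.
elim: n m => [|n IH] m mn.
  have m0 j : m j = 0%N by move/eqP: mn; rewrite sum_nat_eq0 => /forallP/(_ j)/eqP.
  rewrite big1 => [|j _]; last by rewrite m0.
  rewrite mul1n (bigD1 (ffun0 (card_ord 0))) //= big1 ?addn0 => [|y /eqP []].
    suff -> : [forall j, type_of (ffun0 (card_ord 0)) j == m j] by [].
    by apply/forallP => j; rewrite typeE big_ord0 m0.
  by apply/ffunP => -[].
pose cons (u : 'I_p * {ffun 'I_n -> 'I_p}) : {ffun 'I_n.+1 -> 'I_p} :=
  [ffun i => if unlift ord0 i is Some i' then u.2 i' else u.1].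
pose uncons (y : {ffun 'I_n.+1 -> 'I_p}) := (y ord0, [ffun i => y (lift ord0 i)]).
rewrite (reindex cons) /=; last first.
  exists uncons => [[j y] _|y _].
    rewrite /uncons /cons; congr (_, _); first by rewrite ffunE unlift_none.
    by apply/ffunP => i; rewrite !ffunE liftK.
  apply/ffunP => i; rewrite ffunE /=; case: unliftP => [i' ->|->] //.
  by rewrite ffunE.
rewrite -(pair_bigA _
  (fun k y => nat_of_bool [forall j, type_of (cons (k, y)) j == m j])) /=.
have typeC k y j : type_of (cons (k, y)) j = ((k == j) + type_of y j)%N.
  rewrite !typeE big_ord_recl ffunE unlift_none; congr (_ + _)%N.
  by apply: eq_bigr => i _; rewrite ffunE liftK.
have -> : (n.+1`! = \sum_j m j * n`!)%N.
  by rewrite factS -[X in (X * _)%N]mn big_distrl.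
rewrite big_distrr /=; apply: eq_bigr => k _.
have [mk0|mk0] := eqVneq (m k) 0%N.
  rewrite mk0 mul0n [X in (_ * X)%N]big1 ?muln0 // => y _.
  by apply/eqP; rewrite eqb0; apply/forallPn; exists k; rewrite typeC mk0 eqxx.
pose m' j := if j == k then (m k).-1 else m j.
have m'n : (\sum_j m' j)%N = n.
  apply: succn_inj; rewrite -mn (bigD1 k) //= [in RHS](bigD1 k) //= /m' eqxx.
  rewrite -addSn prednK ?lt0n //; congr (_ + _)%N.
  by apply: eq_bigr => j /negPf ->.
rewrite -(IH m' m'n) mulnA; congr (_ * _)%N.
  rewrite (bigD1 k) //= [in RHS](bigD1 k) //= /m' eqxx mulnA; congr (_ * _)%N.
    by case: (m k) mk0.
  by apply: eq_bigr => j /negPf ->.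
apply: eq_bigr => y _; congr nat_of_bool; apply: eq_forallb => j.
rewrite typeC /m' (eq_sym k); have [->|_] := eqVneq j k; last by [].
by case: (m k) mk0.
Qed.

Section MultinomialSum.
Context {R : realType} {n p : nat}.
Hypotheses (n0 : (0 < n)%N) (p0 : (0 < p)%N).

Lemma multinomialE (m : {ffun 'I_p -> 'I_n.+1}) : (\sum_j m j)%N = n ->
  multinomial m =
  (\sum_(y : {ffun 'I_n -> 'I_p}) [forall j, type_of y j == m j])%N%:R :> R.
Proof.
move=> mn; rewrite /multinomial -(card_type_of mn) natrM mulrAC mulfV ?mul1r //.
by rewrite pnatr_eq0 -lt0n prodn_gt0 // => j; exact: fact_gt0.
Qed.

(** The sum counts the words whose letter sum is divisible by [p], a fraction [1 / p] of all words
    by [card_zero_sum]. This saving pays for the [p] peaks. *)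
Lemma sum_multinomial_le :
  p%:R * \sum_(m : {ffun 'I_p -> 'I_n.+1} |
            ((\sum_j m j)%N == n) && (p %| \sum_j m j * j)%N) multinomial m <=
  p%:R ^+ n :> R.
Proof.
rewrite -natrX -(card_zero_sum p0 n0) natrM ler_wpM2l //.
under eq_bigr => m /andP[/eqP mn _] do rewrite (multinomialE mn).
rewrite -natr_sum ler_nat exchange_big /= -sum1_card [leqRHS]big_mkcond /=.
apply: leq_sum => y _.
pose m0 : {ffun 'I_p -> 'I_n.+1} := [ffun j => inord (type_of y j)].
rewrite big_mkcond (bigD1 m0) //= [X in (_ + X)%N]big1 ?addn0 => [|m mm0]; last first.
  case: ifP => // _; apply/eqP; rewrite eqb0; apply: contra mm0 => /forallP my.
  apply/eqP/ffunP => j; apply: val_inj.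
  by rewrite [X in _ = nat_of_ord X]ffunE (eqP (my j)) /= inord_val.
have m0E j : m0 j = type_of y j :> nat.
  by rewrite ffunE inordK // ltnS type_of_le.
have -> : (\sum_(j < p) m0 j * j = \sum_i y i)%N.
  have /= -> := sum_type_of y (fun j => j).
  by apply: eq_bigr => j _; rewrite m0E.
rewrite inE; case: (p %| _)%N; rewrite ?andbF // andbT.
by case: ifP => // _; exact: leq_b1.
Qed.

End MultinomialSum.

(** * Stirling type estimates *)

Section ExpInequalities.
Context {R : realType}.
Implicit Types (t y : R).

Lemma ge0_of_derive (f df : R -> R) t :
  (forall x : R, is_derive x (1 : R) f (df x)) ->
  (forall x : R, 0 <= x -> 0 <= df x) ->
  f 0 = 0 -> 0 <= t -> 0 <= f t.
Proof.
move=> fd df0 f0 t0; rewrite -f0.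
apply: (@ger0_derive1_ndecr _ f 0 t) => // [x|].
  rewrite in_itv /= => /andP[x0 _]; have [_ e] := fd x.
  by rewrite derive1E e df0 // ltW.
by apply: derivable_within_continuous => x _; case: (fd x).
Qed.

Lemma le_sinh t : 0 <= t -> 2 * t <= expR t - expR (- t).
Proof.
move=> t0; rewrite -subr_ge0.
pose f (x : R) := expR x - expR (- x) - 2 * x.
pose df (x : R) := expR x + expR (- x) - 2.
apply: (@ge0_of_derive f df t) => //.
- move=> x; rewrite /f /df.
  apply: is_derive_eq; rewrite /= /GRing.scale /=; ring.
- move=> x _; rewrite /df.
  by have := expR_ge1Dx x; have := expR_ge1Dx (- x); lra.
by rewrite /f oppr0 expR0; lra.
Qed.

(** This is [tanh (t / 2) <= t / 2] cleared of denominators. *)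
Lemma tanh_le t : 0 <= t -> 2 * (expR t - 1) <= t * (expR t + 1).
Proof.
move=> t0; rewrite -subr_ge0.
pose f (x : R) := x * (expR x + 1) - 2 * (expR x - 1).
pose df (x : R) := x * expR x + 1 - expR x.
apply: (@ge0_of_derive f df t) => //.
- move=> x; rewrite /f /df.
  apply: is_derive_eq; rewrite /= /GRing.scale /=; ring.
- move=> x _; rewrite /df.
  have := ler_wpM2r (expR_ge0 x) (expR_ge1Dx (- x)).
  by rewrite -expRD addNr expR0; lra.
by rewrite /f expR0; lra.
Qed.

Lemma ln_le_sinh y : 1 <= y -> 2 * ln y <= y - y^-1.
Proof.
move=> y1; have y0 : 0 < y by lra.
by have := le_sinh (ln_ge0 y1); rewrite expRN lnK.
Qed.

Lemma ln_ge_tanh y : 1 <= y -> 2 * (y - 1) / (y + 1) <= ln y.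
Proof.
move=> y1; have y0 : 0 < y by lra.
have := tanh_le (ln_ge0 y1); rewrite lnK //.
by rewrite ler_pdivrMr //; lra.
Qed.

(** For [y = 1 + 1 / k], the bound [ln_ge_tanh] times [2 * k + 1] is exactly 2, and [ln_le_sinh]
    exceeds it by [1 / (2 * k * (k + 1))], written so as to telescope. *)
Lemma ler_stirling_step (k : nat) : (0 < k)%N ->
  @expR R 2 <= (1 + k%:R^-1) ^+ (2 * k).+1 <=
  @expR R (2 + (k%:R^-1 - k.+1%:R^-1) / 2).
Proof.
move=> k0; set x : R := k%:R.
have x0 : 0 < x by rewrite ltr0n.
have y1 : 1 <= 1 + x^-1 by rewrite lerDl invr_ge0 ltW.
have -> : (1 + x^-1) ^+ (2 * k).+1 = expR (ln (1 + x^-1) * (2 * x + 1)).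
  have -> : 2 * x + 1 = (2 * k).+1%:R by rewrite -[in RHS]natr1 natrM.
  rewrite expRM_natr lnK // posrE; lra.
have -> : k.+1%:R = x + 1 by rewrite -natr1.
rewrite !ler_expR; apply/andP; split.
  apply: le_trans (_ : 2 * (1 + x^-1 - 1) / (1 + x^-1 + 1) * (2 * x + 1) <= _).
    rewrite le_eqVlt; apply/orP; left; apply/eqP; field.
    by apply/andP; split; rewrite gt_eqF //; lra.
  by apply: ler_wpM2r (ln_ge_tanh y1); lra.
have h := ln_le_sinh y1.
apply: (@le_trans _ _ ((1 + x^-1 - (1 + x^-1)^-1) / 2 * (2 * x + 1))).
  by apply: ler_wpM2r; lra.
rewrite le_eqVlt; apply/orP; left; apply/eqP; field.
by rewrite !gt_eqF //; lra.
Qed.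

End ExpInequalities.

Section Stirling.
Context {R : realType}.

(* The probability that a Poisson variable of parameter [k] is equal to [k]. *)
Definition poisson_mode (k : nat) : R := k%:R ^+ k * expR (- k%:R) / k`!%:R.

Local Notation g := poisson_mode.
(* Nondecreasing in [k], with limit [1 / (2 pi)]. As [central_prob (2 * k) / g k]
   is expressed through ratios of values of [h], this limit plays no role. *)
Let h (k : nat) : R := k%:R * g k ^+ 2.

Lemma poisson_mode_gt0 k : (0 < k)%N -> 0 < g k.
Proof.
by move=> k0; rewrite divr_gt0 ?mulr_gt0 ?exprn_gt0 ?expR_gt0 ?ltr0n ?fact_gt0.
Qed.

Let h_gt0 k : (0 < k)%N -> 0 < h k.
Proof. by move=> k0; rewrite mulr_gt0 ?ltr0n // exprn_gt0 // poisson_mode_gt0. Qed.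

Let hS k : (0 < k)%N -> h k.+1 = h k * ((1 + k%:R^-1) ^+ (2 * k).+1 * expR (- 2)).
Proof.
move=> k0; have x0 : k%:R != 0 :> R by rewrite pnatr_eq0 -lt0n.
have y0 : k.+1%:R != 0 :> R by rewrite pnatr_eq0.
have f0 : k`!%:R != 0 :> R by rewrite pnatr_eq0 -lt0n fact_gt0.
have -> : 1 + k%:R^-1 = k.+1%:R / k%:R :> R by rewrite -natr1; field.
rewrite /h /g factS natrM.
have -> : expR (- k.+1%:R) = expR (- k%:R) * expR (-1) :> R.
  by rewrite -expRD -natr1 opprD.
have -> : expR (- 2) = expR (-1) ^+ 2 :> R by rewrite -expRM_natr mulN1r.
move: (expR _) (expR _) => e1 e2; move: y0; move: (k.+1%:R) => y y0.
have -> : (y / k%:R) ^+ (2 * k).+1 = y / k%:R * (y ^+ k / k%:R ^+ k) ^+ 2.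
  by rewrite exprS mulnC exprM expr_div_n.
have xk0 : k%:R ^+ k != 0 :> R by rewrite expf_neq0.
rewrite (exprS y); move: (y ^+ k) => yk; move: xk0; move: (k%:R ^+ k) => xk xk0.
by field; rewrite x0 y0 f0 xk0.
Qed.

Let hS_bounds k : (0 < k)%N ->
  h k <= h k.+1 <= h k * expR ((k%:R^-1 - k.+1%:R^-1) / 2).
Proof.
move=> k0; have /andP[lo hi] := @ler_stirling_step R k k0; rewrite hS //.
have h0 := h_gt0 k0; apply/andP; split.
  by rewrite ler_peMr ?(ltW h0) // expRN ler_pdivlMr ?expR_gt0 // mul1r.
by rewrite ler_pM2l // expRN ler_pdivrMr ?expR_gt0 // -expRD (addrC _ 2).
Qed.

Let h_bounds k i : (0 < k)%N ->
  h k <= h (i + k) <= h k * expR ((k%:R^-1 - (i + k)%:R^-1) / 2).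
Proof.
move=> k0; elim: i => [|i /andP[IH1 IH2]].
  by rewrite add0n subrr mul0r expR0 mulr1 lexx.
have ik0 : (0 < i + k)%N by rewrite addn_gt0 k0 orbT.
have /andP[s1 s2] := hS_bounds ik0; rewrite addSn; apply/andP; split.
  exact: le_trans s1.
apply: le_trans s2 _.
apply: (@le_trans _ _ (h k * expR ((k%:R^-1 - (i + k)%:R^-1) / 2) *
  expR (((i + k)%:R^-1 - (i + k).+1%:R^-1) / 2))).
  by rewrite ler_wpM2r ?expR_ge0.
by rewrite -mulrA -expRD -mulrDl subrKA.
Qed.

Let h2_bounds k : (0 < k)%N -> h k <= h (2 * k) <= h k * expR ((2 * k%:R)^-1).
Proof.
move=> k0; have /andP[h1 h2] := h_bounds k k0.
rewrite mul2n -addnn h1 /=; apply: le_trans h2 _.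
rewrite ler_wpM2l ?(ltW (h_gt0 k0)) // ler_expR (mulrC 2) invfM.
rewrite ler_wpM2r ?invr_ge0 //.
by rewrite gerBl invr_ge0.
Qed.

Lemma central_prob_ge0 k : 0 <= central_prob k :> R.
Proof. by rewrite divr_ge0 ?exprn_ge0. Qed.

(** Two independent Poisson variables of parameter [k], conditioned on having sum [2 * k], follow a
    binomial law; the quotient is its central probability. *)
Lemma central_probE k : (0 < k)%N -> central_prob k = g k ^+ 2 / g (2 * k).
Proof.
move=> k0; rewrite /central_prob /g.
have k2 : (k <= 2 * k)%N by rewrite leq_pmull.
have x0 : k%:R != 0 :> R by rewrite pnatr_eq0 -lt0n.
have f0 n : n`!%:R != 0 :> R by rewrite pnatr_eq0 -lt0n fact_gt0.
have -> : 'C(2 * k, k)%:R = (2 * k)`!%:R / k`!%:R ^+ 2 :> R.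
  have kk : (2 * k - k = k)%N by lia.
  by rewrite -(bin_fact k2) kk !natrM; field.
have -> : expR (- (2 * k)%:R) = expR (- k%:R) ^+ 2 :> R.
  by rewrite -expRM_natr natrM; congr expR; ring.
have -> : (2 * k)%:R ^+ (2 * k) = 4 ^+ k * (k%:R ^+ k) ^+ 2 :> R.
  rewrite natrM exprMn; congr (_ * _); last by rewrite mulnC exprM.
  by rewrite exprM; congr (_ ^+ k); rewrite -natrX.
have e0 : expR (- k%:R) != 0 :> R by rewrite gt_eqF ?expR_gt0.
have xk0 : k%:R ^+ k != 0 :> R by rewrite expf_neq0.
have x4 : (4 : R) ^+ k != 0 by rewrite expf_neq0 // pnatr_eq0.
field; by rewrite e0 xk0 x4 !f0.
Qed.

Let central_sqr k : (0 < k)%N ->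
  (central_prob (2 * k) / g k) ^+ 2 = h (2 * k) ^+ 2 / (h (2 * (2 * k)) * h k).
Proof.
move=> k0; rewrite central_probE ?muln_gt0 //.
have g1 := poisson_mode_gt0 k0.
have g2 : 0 < g (2 * k) by rewrite poisson_mode_gt0 ?muln_gt0.
have g4 : 0 < g (2 * (2 * k)) by rewrite poisson_mode_gt0 ?muln_gt0.
have x0 : k%:R != 0 :> R by rewrite pnatr_eq0 -lt0n.
by rewrite /h !natrM; field; rewrite x0 !gt_eqF.
Qed.

(** In [central_sqr], monotonicity of [h] removes one quotient and [h2_bounds] bounds the other by
    [expR (1 / (2 * k))]; the square root halves the exponent. *)
Lemma central_prob_le k : (0 < k)%N ->
  central_prob (2 * k) <= g k * expR ((4 * k%:R)^-1).
Proof.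
move=> k0; have g0 := poisson_mode_gt0 k0.
have k20 : (0 < 2 * k)%N by rewrite muln_gt0.
have k40 : (0 < 2 * (2 * k))%N by rewrite muln_gt0.
have /andP[a1 a2] := h2_bounds k0; have /andP[b1 b2] := h2_bounds k20.
have [h1 h2 h4] := And3 (h_gt0 k0) (h_gt0 k20) (h_gt0 k40).
rewrite mulrC -ler_pdivrMr //.
rewrite -(@ler_pXn2r _ 2) ?nnegrE ?expR_ge0 ?divr_ge0 ?(ltW g0) //.
rewrite central_sqr // -expRM_natr.
rewrite ler_pdivrMr; last exact: mulr_gt0.
have -> : (4 * k%:R)^-1 * 2 = (2 * k%:R)^-1 :> R.
  by have x0 : k%:R != 0 :> R; [rewrite pnatr_eq0 -lt0n | field].
have -> (e x y : R) : e * (x * y) = x * (y * e) by ring.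
by rewrite expr2; apply: ler_pM => //; exact: ltW.
Qed.

Lemma central_prob_ge k : (0 < k)%N ->
  g k * expR (- (8 * k%:R)^-1) <= central_prob (2 * k).
Proof.
move=> k0; have g0 := poisson_mode_gt0 k0.
have k20 : (0 < 2 * k)%N by rewrite muln_gt0.
have k40 : (0 < 2 * (2 * k))%N by rewrite muln_gt0.
have /andP[a1 a2] := h2_bounds k0; have /andP[b1 b2] := h2_bounds k20.
have [h1 h2 h4] := And3 (h_gt0 k0) (h_gt0 k20) (h_gt0 k40).
rewrite mulrC -ler_pdivlMr //.
rewrite -(@ler_pXn2r _ 2) ?nnegrE ?expR_ge0 ?divr_ge0 ?(ltW g0) //.
rewrite central_sqr // -expRM_natr.
rewrite ler_pdivlMr; last exact: mulr_gt0.
have -> : - (8 * k%:R)^-1 * 2 = - (2 * (2 * k)%:R)^-1 :> R.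
  by rewrite natrM; have x0 : k%:R != 0 :> R; [rewrite pnatr_eq0 -lt0n | field].
rewrite expRN mulrC ler_pdivrMr ?expR_gt0 //.
have -> (e x : R) : x ^+ 2 * e = (x * e) * x by ring.
by apply: ler_pM => //; exact: ltW.
Qed.

(** From [h k >= h 1 = expR (- 2)] one gets [g k ^+ 2 >= expR (- 2) / k]; weakening [k] to [k ^+ 2]
    avoids a square root. *)
Lemma poisson_mode_ge k : (0 < k)%N -> (expR 1 * k%:R)^-1 <= g k.
Proof.
move=> k0; have g0 := poisson_mode_gt0 k0.
have x1 : 1 <= k%:R :> R by rewrite ler1n.
have h1E : h 1 = expR (-2).
  by rewrite /h /g mul1r expr1 mul1r divr1 -expRM_natr mulN1r.
have /andP[h1 _] := h_bounds (k - 1) (isT : 0 < 1)%N; rewrite subnK // h1E in h1.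
rewrite -(@ler_pXn2r _ 2) ?nnegrE ?(ltW g0) ?invr_ge0 ?mulr_ge0 ?expR_ge0 //.
rewrite exprVn exprMn invfM -expRM_natr mul1r -expRN mulrC.
rewrite ler_pdivrMl ?exprn_gt0 //; last by lra.
apply: le_trans h1 _; rewrite /h ler_wpM2r ?exprn_ge0 ?(ltW g0) //.
by rewrite expr2 ler_peMr //; lra.
Qed.

End Stirling.

(** * The local limit bound *)

Section LocalLimit.
Context {R : realType}.

(** The constant in the threshold [eta], chosen so that [eta / 2 - beta = 3 * p * ln n / n]. *)
Definition peak_const (b : R) : R := 2 * b + 6.

Definition window_const (d : nat) (b : R) : R := d%:R * peak_const b / 2 + 2.

(** The leading [t] covers the points far from all peaks, the square root the other shifts near a
    peak, the next term the second order and Stirling errors, and the denominator [Gap]. *)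
Definition error_factor (d : nat) (b t : R) : R :=
  t + expR (2 * Num.sqrt ((b + peak_const b) ^+ 3 * t) +
            (4 * window_const d b ^+ 2 + 1) * t) / (1 - (1 + expR 1) * t).

Lemma poisson_mode_le1 k : (0 < k)%N -> poisson_mode k <= 1 :> R.
Proof.
case: k => // k _; rewrite /poisson_mode ler_pdivrMr ?ltr0n ?fact_gt0 // mul1r.
rewrite expRN ler_pdivrMr ?expR_gt0 //.
have := @expR_ge1Dxn R k.+1%:R k (ler0n _ _).
have f0 : 0 < k.+1`!%:R :> R by rewrite ltr0n fact_gt0.
by move=> h; rewrite mulrC -ler_pdivrMr //; apply: le_trans h; rewrite lerDr.
Qed.

Lemma sum_zero_sum_poly_le_mode (d n p l Q : nat) (z : R[i]) (b : R)
    (m : 'I_p -> nat) :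
  (p * Q = l.+1)%N -> l.+1.-primitive_root z -> (3 <= d)%N -> (0 < n)%N ->
  (4 * (d * n) < l.+1)%N -> (\sum_j m j)%N = n -> 1 <= b ->
  \sum_(j < p) ((m j)%:R / n%:R - p%:R^-1) ^+ 2 <= b * ln n%:R / n%:R ->
  let x := ln n%:R in let t := p%:R ^+ 3 * x ^+ 3 / n%:R in
  1 <= x -> 1 + ln d%:R <= x ->
  (b + peak_const b) * t <= 1 -> d%:R * peak_const b * t <= 1/2 ->
  2 * window_const d b * t <= 1/4 -> 4 * b * t <= 1 -> (1 + expR 1) * t <= 1/2 ->
  \sum_(a : {ffun 'I_p -> 'I_l.+1})
     Normc.normc (p%:R * zero_sum_poly z d (fun j => (m j)%:R / n%:R) a) ^+ n <=
  l.+1%:R ^+ p * (p%:R * error_factor d b t *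
    (\prod_j poisson_mode (d * m j) / poisson_mode (d * n))).
Proof.
move=> pQ zP d3 n0 nl mn b1 equi x t x1 dx tW td tD tb te.
have p0 : (0 < p)%N by move: pQ; case: (p).
have d0 : (0 < d)%N by apply: leq_trans d3.
have N0 : (0 < d * n)%N by rewrite muln_gt0 d0.
have nR : 0 < n%:R :> R by rewrite ltr0n.
have pR : 0 < p%:R :> R by rewrite ltr0n.
have dR : 0 < d%:R :> R by rewrite ltr0n.
have NR : 0 < (d * n)%:R :> R by rewrite ltr0n.
have p1 : 1 <= p%:R :> R by rewrite ler1n.
have d1 : 3 <= d%:R :> R by rewrite ler_nat.
have x0 : 0 <= x by lra.
have x0' : 0 < x by lra.
pose C := peak_const b; pose D := window_const d b.
have CE : C = 2 * b + 6 by [].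
have DE : D = d%:R * C / 2 + 2 by [].
have C0 : 0 <= C by lra.
have D0 : 0 <= D by rewrite DE; have := mulr_ge0 (ltW dR) C0; lra.
have t0 : 0 < t by rewrite divr_gt0 // mulr_gt0 // exprn_gt0.
(* As [p] and [x] are at least 1, [t] absorbs every error of this shape. *)
have monomial_le i k : (i <= 3)%N -> (k <= 3)%N -> p%:R ^+ i * x ^+ k / n%:R <= t.
  move=> i3 k3; rewrite /t ler_pM2r ?invr_gt0 //.
  apply: ler_pM; rewrite ?exprn_ge0 //.
    exact: ler_weXn2l.
  exact: ler_weXn2l.
pose s := p%:R * x / n%:R.
have s0 : 0 < s by rewrite divr_gt0 // mulr_gt0.
have st : s <= t by have := monomial_le 1%N 1%N isT isT; rewrite !expr1.
have ns : n%:R * s = p%:R * x by rewrite /s mulrC divfK // gt_eqF.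
pose eta := C * s; pose beta := b * s; pose tau : R := ln (d * n)%:R / (d * n)%:R.
(* Half the average of the counts [d * m j]. *)
pose mu : R := (d * n)%:R / (2 * p%:R).
have mu0 : 0 < mu by rewrite divr_gt0 // mulr_gt0.
(* The [- 1] absorbs the factor [expR 1] of [poisson_mode_ge] in [far_le]. *)
have lnN : ln (d * n)%:R <= 2 * x - 1.
  by rewrite natrM lnM ?posrE //; move: dx; rewrite -/x; lra.
have q2 : p%:R * \sum_j ((m j)%:R / n%:R) ^+ 2 <= 1 + beta.
  have sq : \sum_(j < p) (m j)%:R / n%:R = 1 :> R.
    by rewrite -mulr_suml -natr_sum mn mulfV // gt_eqF.
  have sqE : \sum_(j < p) ((m j)%:R / n%:R - p%:R^-1) ^+ 2 =
      \sum_(j < p) ((m j)%:R / n%:R) ^+ 2 - p%:R^-1 :> R.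
    rewrite (eq_bigr (fun j => ((m j)%:R / n%:R) ^+ 2 +
      ((- 2 * p%:R^-1) * ((m j)%:R / n%:R) + p%:R^-1 ^+ 2))); last by move=> j _; ring.
    rewrite !big_split /= -mulr_sumr sq sumr_const card_ord.
    rewrite -[X in _ + (_ + X)]mulr_natl.
    by field; rewrite gt_eqF.
  have -> : \sum_(j < p) ((m j)%:R / n%:R) ^+ 2 =
      \sum_(j < p) ((m j)%:R / n%:R - p%:R^-1) ^+ 2 + p%:R^-1 :> R.
    by rewrite sqE subrK.
  rewrite mulrDr mulfV ?gt_eqF // addrC lerD2l.
  apply: (le_trans (ler_wpM2l (ltW pR) equi)); rewrite /beta /s -/x.
  by rewrite le_eqVlt; apply/orP; left; apply/eqP; ring.
(* A smaller share would alone contribute more than [1 / (4 * p ^ 2)] to the sum of squares, against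
   [4 * b * t <= 1]. *)
have mj_ge j : (2 * p%:R)^-1 <= (m j)%:R / n%:R :> R.
  rewrite leNgt; apply/negP => mlt.
  have : ((m j)%:R / n%:R - p%:R^-1) ^+ 2 <= b * x / n%:R.
    apply: le_trans equi; rewrite (bigD1 j) //= lerDl.
    by apply: sumr_ge0 => i _; exact: sqr_ge0.
  have pp : p%:R^-1 = 2 * (2 * p%:R)^-1 :> R by field; rewrite gt_eqF.
  have i0 : 0 < (2 * p%:R)^-1 :> R by rewrite invr_gt0 mulr_gt0.
  move: mlt i0; rewrite pp; set y := _ / n%:R; set i := (2 * _)^-1 => yi i0.
  have iy : i ^+ 2 < (y - 2 * i) ^+ 2.
    have -> : (y - 2 * i) ^+ 2 = (2 * i - y) ^+ 2 by ring.
    by rewrite ltr_pXn2r ?nnegrE //; lra.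
  move=> yb; have := lt_le_trans iy yb; rewrite ltNge => /negP; apply.
  rewrite /i exprVn -[leRHS]mul1r ler_pdivlMr ?exprn_gt0 ?mulr_gt0 // mulrC.
  apply: le_trans tb.
  have := ler_wpM2l (ltW (lt_le_trans ltr01 b1)) (monomial_le 2%N 1%N isT isT).
  rewrite expr1; set T := b * (_ / _) => bT.
  have -> : (2 * p%:R) ^+ 2 * (b * x / n%:R) = 4 * T by rewrite /T; ring.
  lra.
have Mmu j : mu <= (d * m j)%:R.
  rewrite /mu !natrM -mulrA ler_pM2l // mulrC -ler_pdivlMr //.
have M0 j : (0 < d * m j)%N by rewrite -(ltr0n R); apply: lt_le_trans (Mmu j).
have ntau : (d * n)%:R * tau = ln (d * n)%:R by rewrite /tau mulrC divfK // gt_eqF.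
have px1 : x <= p%:R * x by rewrite ler_peMl.
have lnN0 : 0 <= ln (d * n)%:R :> R by rewrite ln_ge0 // ler1n.
have neta : (d * n)%:R * eta = d%:R * C * (p%:R * x).
  by rewrite -ns /eta natrM; ring.
pose Lam := (d * n)%:R * eta / 2 + (d * n)%:R * tau.
have Lam_le : Lam <= D * (p%:R * x).
  rewrite /Lam ntau neta DE [leRHS]mulrDl.
  have -> : d%:R * C / 2 * (p%:R * x) = d%:R * C * (p%:R * x) / 2 by ring.
  by rewrite lerD2l; lra.
have Lam0 : 0 <= Lam.
  by rewrite /Lam ntau neta addr_ge0 // divr_ge0 // !mulr_ge0.
have dpx0 : 0 <= D * (p%:R * x) by rewrite !mulr_ge0 // ltW.
have Lam_mu : Lam / mu <= 2 * D * t.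
  apply: (@le_trans _ _ (2 * D * (p%:R ^+ 2 * x ^+ 1 / n%:R))); last first.
    by apply: ler_wpM2l; [rewrite mulr_ge0 | exact: monomial_le].
  rewrite ler_pdivrMr //; apply: le_trans Lam_le _.
  have -> : 2 * D * (p%:R ^+ 2 * x ^+ 1 / n%:R) * mu = d%:R * (D * (p%:R * x)).
    by rewrite /mu natrM; field; rewrite !gt_eqF.
  by rewrite ler_peMl //; lra.
have Lam2_mu : 2 * Lam ^+ 2 / mu <= 4 * D ^+ 2 * t.
  apply: (@le_trans _ _ (4 * D ^+ 2 * (p%:R ^+ 3 * x ^+ 2 / n%:R))); last first.
    by apply: ler_wpM2l; [rewrite mulr_ge0 // sqr_ge0 | exact: monomial_le].
  rewrite ler_pdivrMr //.
  have -> : 4 * D ^+ 2 * (p%:R ^+ 3 * x ^+ 2 / n%:R) * mu =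
      d%:R * (2 * (D * (p%:R * x)) ^+ 2).
    by rewrite /mu natrM; field; rewrite !gt_eqF.
  apply: (@le_trans _ _ (2 * (D * (p%:R * x)) ^+ 2)).
    by rewrite ler_pM2l // lerXn2r ?nnegrE.
  by rewrite ler_peMl ?mulr_ge0 ?sqr_ge0 //; lra.
pose E1 : R := expR 1; pose gN : R := poisson_mode (d * n).
have E1_0 : 0 < E1 by exact: expR_gt0.
have gN0 : 0 < gN by exact: poisson_mode_gt0.
have iN : (d * n)%:R^-1 <= t.
  apply: (@le_trans _ _ (n%:R^-1)).
    by rewrite lef_pV2 ?posrE // ler_nat leq_pmull.
  by have := monomial_le 0%N 0%N isT isT; rewrite !expr0 !mul1r.
have iN0 : 0 < (d * n)%:R^-1 :> R by rewrite invr_gt0.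
(* [tau] is chosen so that [expR (- (2 * N * tau)) = N ^- 2] is negligible with
   respect to [central_prob (2 * N)], which is of order [N ^- (1/2)]. *)
pose Gap := central_prob (2 * (d * n)) - expR (- (2 * (d * n)%:R * tau)) : R.
have GapE : gN * (1 - (1 + E1) * t) <= Gap.
  have c1 : gN * (1 - (d * n)%:R^-1) <= central_prob (2 * (d * n)).
    apply: le_trans (central_prob_ge N0); rewrite -/gN ler_pM2l //.
    apply: le_trans (expR_ge1Dx _).
    by rewrite lerD2l lerN2 invfM ler_piMl ?ltW //; lra.
  have c2 : expR (- (2 * (d * n)%:R * tau)) <= gN * (E1 * (d * n)%:R^-1).
    rewrite -mulrA ntau expRN expRM_natl lnK ?posrE //.
    have -> : (d * n)%:R ^- 2 = (E1 * (d * n)%:R)^-1 * (E1 * (d * n)%:R^-1) :> R.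
      by field; rewrite !gt_eqF.
    by rewrite ler_pM2r ?mulr_gt0 // poisson_mode_ge.
  rewrite /Gap; apply: le_trans (lerB c1 c2); rewrite -mulrBr ler_pM2l //.
  have : (1 + E1) * (d * n)%:R^-1 <= (1 + E1) * t by rewrite ler_pM2l //; lra.
  lra.
have Gap0 : 0 < Gap.
  by apply: lt_le_trans GapE; rewrite mulr_gt0 //; move: te; rewrite -/E1; lra.
pose PM := \prod_j poisson_mode (d * m j) / gN : R.
have gM0 j : 0 < poisson_mode (d * m j) :> R by exact: poisson_mode_gt0.
have prodg0 : 0 < \prod_j poisson_mode (d * m j) :> R by exact: prodr_gt0.
have PM0 : 0 < PM by exact: divr_gt0.
(* The exponent is [3 * p * x]. One third gives at most [1 / n <= t]; the rest lies below [PM],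
   whose numerator has [p] factors of size at least [expR (- (2 * x))] and whose denominator is at
   most 1. *)
have far_le : expR (- (n%:R * (eta / 2 - beta))) <= p%:R * t * PM.
  have -> : n%:R * (eta / 2 - beta) = x * p%:R + 2 * x * p%:R.
    have -> : eta / 2 - beta = 3 * s by rewrite /eta /beta CE; field.
    by rewrite mulrCA ns; ring.
  rewrite opprD expRD.
  have ex : expR (- (x * p%:R)) <= p%:R * t.
    apply: (@le_trans _ _ (n%:R^-1)).
      rewrite expRN lef_pV2 ?posrE ?expR_gt0 // -[leLHS](lnK (x := n%:R)) ?posrE //.
      by rewrite ler_expR mulrC.
    have := monomial_le 0%N 0%N isT isT; rewrite !expr0 !mul1r => h.
    apply: le_trans h _.
    by rewrite ler_peMl // ltW.
  apply: ler_pM; rewrite ?expR_ge0 //.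
  rewrite /PM ler_pdivlMr //; apply: (@le_trans _ _ (expR (- (2 * x * p%:R)))).
    by rewrite ler_piMr ?expR_ge0 // poisson_mode_le1.
  rewrite -mulNr expRM_natr -[in leLHS](card_ord p) -prodr_const.
  apply: ler_prod => j _; rewrite expR_ge0 /=.
  apply: le_trans (poisson_mode_ge (M0 j)).
  rewrite expRN lef_pV2 ?posrE ?expR_gt0 ?mulr_gt0 ?expR_gt0 ?ltr0n //.
  apply: (@le_trans _ _ (expR 1 * (d * n)%:R)).
    rewrite ler_pM2l ?expR_gt0 // ler_nat leq_mul // -mn.
    by rewrite (bigD1 j) //= leq_addr.
  by rewrite -[X in _ * X](lnK (x := (d * n)%:R)) ?posrE // -expRD ler_expR; lra.
have prod_le : \prod_j central_prob (2 * (d * m j)) <=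
    (\prod_j poisson_mode (d * m j)) * expR t.
  apply: (@le_trans _ _ ((\prod_j poisson_mode (d * m j)) *
      \prod_(j < p) expR ((4 * mu)^-1))).
    rewrite -big_split /=; apply: ler_prod => j _; rewrite central_prob_ge0 /=.
    apply: le_trans (central_prob_le (M0 j)) _; rewrite ler_pM2l // ler_expR.
    have mj : 4 * mu <= 4 * (d * m j)%:R by rewrite ler_pM2l.
    by rewrite lef_pV2 // posrE mulr_gt0 ?ltr0n.
  rewrite ler_pM2l // prodr_const card_ord -expRM_natr ler_expR.
  apply: le_trans (monomial_le 2%N 0%N isT isT); rewrite expr0 mulr1.
  have -> : (4 * mu)^-1 * p%:R = (2 * d%:R)^-1 * (p%:R ^+ 2 / n%:R).
    by rewrite /mu natrM; field; rewrite !gt_eqF.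
  rewrite ler_piMl ?divr_ge0 ?sqr_ge0 // invf_le1 ?mulr_gt0 //; lra.
(* The square of [n * (eta + beta) ^ (3/2)] is exactly [(b + C) ^+ 3 * t], whence the cubes in
   [t]. *)
have root_le : 2 * n%:R * ((eta + beta) * Num.sqrt (eta + beta)) <=
    2 * Num.sqrt ((b + C) ^+ 3 * t).
  have ebE : eta + beta = (b + C) * s by rewrite /eta /beta; ring.
  have bC0 : 0 <= b + C by lra.
  have bCs : 0 <= (b + C) * s by rewrite mulr_ge0 // ltW.
  rewrite -mulrA ler_pM2l // ebE mulrA.
  have -> : n%:R * ((b + C) * s) = Num.sqrt ((n%:R * ((b + C) * s)) ^+ 2).
    by rewrite sqrtr_sqr ger0_norm // mulr_ge0.
  rewrite -sqrtrM ?sqr_ge0 // ler_wsqrtr // le_eqVlt; apply/orP; left; apply/eqP.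
  by rewrite /s /t; field; rewrite gt_eqF.
have den0 : 0 < 1 - (1 + E1) * t by move: te; rewrite -/E1; lra.
have := @sum_zero_sum_poly_le R p l Q z pQ zP d n m d3 n0 mn nl eta beta tau mu.
rewrite -/Lam -/Gap => main.
have {}main := main q2.
have {}main := main (mulr_ge0 (le_trans ler01 b1) (ltW s0)).
have {}main := main (mulr_ge0 C0 (ltW s0)).
have {main}/main main : eta + beta <= 1.
  apply: le_trans tW; rewrite /eta /beta -mulrDl (addrC C).
  by apply: ler_wpM2l => //; rewrite addr_ge0 //; lra.
have {main}/main main : d%:R * eta <= 1/2.
  apply: le_trans td; rewrite /eta mulrA.
  by apply: ler_wpM2l => //; rewrite mulr_ge0 // ltW.
have {}main := main mu0 Mmu (le_trans Lam_mu tD).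
have {main}/main main :
    expR (- (2 * (d * n)%:R * tau)) < central_prob (2 * (d * n)) :> R.
  by rewrite -subr_gt0.
apply: le_trans main _; apply: ler_wpM2l; first by rewrite exprn_ge0.
rewrite -/gN -/PM /error_factor -/C -/D -/E1.
have -> (u1 u2 u3 u4 : R) :
  u1 * (u2 + u3) * u4 = u1 * u2 * u4 + u1 * u3 * u4 by ring.
apply: lerD => //.
set A := expR (_ + _ / mu); set B := expR (_ + _ * t).
have AB : A * expR t <= B.
  rewrite /A /B -expRD ler_expR (mulrDl (4 * D ^+ 2)) mul1r addrA lerD2r.
  exact: lerD root_le Lam2_mu.
rewrite -!mulrA ler_pM2l //.
apply: (@le_trans _ _ (A * ((\prod_j poisson_mode (d * m j)) * expR t / Gap))).
  by rewrite ler_pM2l ?expR_gt0 // ler_pM2r ?invr_gt0.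
have -> (u1 u2 u3 u4 : R) : u1 * (u2 * u3 / u4) = (u1 * u3) * (u2 / u4) by ring.
apply: ler_pM => //.
- by rewrite mulr_ge0 ?expR_ge0.
- by rewrite ltW // divr_gt0.
rewrite /PM mulrCA ler_pM2l // -invfM lef_pV2 ?posrE //; first by rewrite mulrC.
by rewrite mulr_gt0.
Qed.

End LocalLimit.

(** * Conclusion *)

Section NonAsymptotic.
Context {R : realType}.

(** Independent Poisson variables of parameters [d * m j], conditioned on having sum [d * n], form a
    multinomial vector; both sides are its probability at the mode. *)
Lemma multinomial_modeE (d n p : nat) (m : 'I_p -> nat) : (0 < d)%N -> (0 < n)%N ->
  (\sum_j m j)%N = n ->
  \prod_j poisson_mode (d * m j) / poisson_mode (d * n) =
  \prod_j ((m j)%:R / n%:R) ^+ (d * m j) *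
  ((d * n)`!%:R / (\prod_j (d * m j)`!)%N%:R) :> R.
Proof.
move=> d0 n0 mn; set N := (d * n)%N.
have MN : (\sum_j d * m j)%N = N by rewrite -big_distrr /= mn.
have f0 k : k`!%:R != 0 :> R by rewrite pnatr_eq0 -lt0n fact_gt0.
have N0 : N%:R != 0 :> R by rewrite pnatr_eq0 -lt0n muln_gt0 d0.
have dR : d%:R != 0 :> R by rewrite pnatr_eq0 -lt0n.
have -> : \prod_j ((m j)%:R / n%:R) ^+ (d * m j) =
    \prod_j (d * m j)%:R ^+ (d * m j) / N%:R ^+ N :> R.
  rewrite -[X in _ ^+ X]MN -prodrXr -prodf_div; apply: eq_bigr => j _.
  rewrite -expr_div_n; congr (_ ^+ _); rewrite !natrM.
  by rewrite -mulf_div mulfV // mul1r.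
have -> : \prod_j poisson_mode (d * m j) = \prod_j (d * m j)%:R ^+ (d * m j) *
    expR (- N%:R) / (\prod_j (d * m j)`!)%N%:R :> R.
  rewrite /poisson_mode prodf_div big_split /= -natr_prod; congr (_ * _ / _).
  by rewrite -expR_sum sumrN -natr_sum MN.
have p0 : (\prod_j (d * m j)`!)%N%:R != 0 :> R.
  by rewrite pnatr_eq0 -lt0n prodn_gt0 // => j; exact: fact_gt0.
have e0 : expR (- N%:R) != 0 :> R by rewrite gt_eqF ?expR_gt0.
have NN0 : N%:R ^+ N != 0 :> R by rewrite expf_neq0.
by rewrite /poisson_mode; field; rewrite e0 NN0 p0 f0.
Qed.

Lemma error_factor_ge0 d b t : 0 <= t -> (1 + expR 1) * t <= 1/2 ->
  0 <= error_factor d b t :> R.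
Proof. by move=> t0 te; rewrite addr_ge0 // divr_ge0 ?expR_ge0 //; lra. Qed.

(** In each term, Fourier inversion and the mode bound cancel the weights and the factorials, up to
    [p * error_factor]. As [p] does not divide [d], the terms where [p] does not divide
    [\sum_j m j * j] vanish, and [sum_multinomial_le] removes the factor [p]. *)
Lemma equidistributed_sum_le (d n p : nat) (b : R) (disp : measure_display)
    (T : measurableType disp) (P : probability T R)
    (X : 'I_n -> T -> {ffun 'I_p -> nat}) :
  (forall i, discrete_rv (X i)) -> (forall i, uniform_over P (U d p) (X i)) ->
  mutually_independent P X ->
  prime p -> ~~ (p %| d)%N -> (3 <= d)%N -> (0 < n)%N -> 1 <= b ->
  let x := ln n%:R in let t := p%:R ^+ 3 * x ^+ 3 / n%:R in
  1 <= x -> 1 + ln d%:R <= x ->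
  (b + peak_const b) * t <= 1 -> d%:R * peak_const b * t <= 1/2 ->
  2 * window_const d b * t <= 1/4 -> 4 * b * t <= 1 -> (1 + expR 1) * t <= 1/2 ->
  equidistributed_sum d b P X <= error_factor d b t.
Proof.
move=> Xm Xu Xi p_pr pd d3 n0 b1 x t x1 dx tW td tD tb te.
have p0 := prime_gt0 p_pr; have d0 : (0 < d)%N by apply: leq_trans d3.
have pR : 0 < p%:R :> R by rewrite ltr0n.
have t0 : 0 <= t by rewrite divr_ge0 // mulr_ge0 ?exprn_ge0 //; lra.
have err0 := error_factor_ge0 d b t0 te.
set err := error_factor d b t in err0 *.
(* [B] dominates [d] and all [d * m j]; [Q] makes [l.+1] a multiple of [p] above all exponents of
   the Fourier argument. *)
pose B := (d * n + d)%N; pose Q := (4 * (d * n) + n * B).+1.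
pose l := (p * Q).-1; have pQ : (p * Q = l.+1)%N by rewrite prednK // muln_gt0 p0.
have Ql : (Q <= l.+1)%N by rewrite -pQ leq_pmull.
have [z zP] := @exists_primitive_root R[i] l.+1 isT.
have term_le (m : {ffun 'I_p -> 'I_n.+1}) : m \in equidistributed b n p ->
    multinomial m * ((p ^ ((d - 1) * n))%N%:R * (\prod_(j < p) (d * m j)`!)%N%:R
         / (d * n)`!%N%:R)
    * fine (P [set w | forall j : 'I_p, (\sum_(i < n) X i w j = d * m j)%N]) <=
    if (p %| \sum_j m j * j)%N then p%:R * err / p%:R ^+ n * multinomial m else 0.
  rewrite inE => /andP[/eqP mn equi].
  have MB j : (d * m j <= B)%N.
    by rewrite (leq_trans _ (leq_addr _ _)) // leq_mul // -ltnS.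
  have := @prob_sum_eq_le _ _ R P d n p X Xm Xu Xi B (fun j => d * m j)%N MB.
  rewrite size_U // => Ple.
  have : 0 <= multinomial m :> R by rewrite divr_ge0.
  move: (multinomial m) => mm mult0.
  apply: (@le_trans _ _ (mm * ((\prod_(j < p) (d * m j)`!)%N%:R
         / (d * n)`!%N%:R) * (word_count d n B (fun j => d * m j)%N)%:R)).
    rewrite -!mulrA; apply: ler_wpM2l => //.
    rewrite mulrCA.
    apply: ler_wpM2l => //.
    rewrite mulrCA; apply: ler_wpM2l; first by rewrite invr_ge0.
    have pn0 : 0 < (p ^ ((d - 1) * n))%N%:R :> R by rewrite ltr0n expn_gt0 p0.
    by rewrite -ler_pdivlMl // mulrC natrX exprM -natrX.
  case: ifPn => [pm|pm]; last first.
    rewrite word_count_eq0 ?mulr0 //.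
    have -> : (\sum_(j < p) d * m j * j = d * \sum_j m j * j)%N.
      by rewrite big_distrr /=; apply: eq_bigr => j _; rewrite mulnA.
    by rewrite Euclid_dvdM // negb_or pd.
  set W := (word_count _ _ _ _)%:R.
  pose q (j : 'I_p) : R := (m j)%:R / n%:R.
  have Ml j : (d * m j < l.+1)%N.
    apply: leq_trans Ql; rewrite ltnS (leq_trans _ (leq_addr _ _)) //.
    by rewrite (leq_trans _ (leq_pmull _ _)) // leq_mul // -ltnS.
  have nBl : (n * B < l.+1)%N by apply: leq_trans Ql; rewrite ltnS leq_addl.
  have nl : (4 * (d * n) < l.+1)%N by apply: leq_trans Ql; rewrite ltnS leq_addr.
  have := word_count_fourier zP p_pr (leq_addl _ _ : d <= B)%N nBl Ml q.
  move/(congr1 (@Normc.normc R)); rewrite normcR; last first.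
    rewrite !mulr_ge0 ?exprn_ge0 ?prodr_ge0 // => j _.
    by rewrite exprn_ge0 // divr_ge0.
  rewrite -/W => Wfourier.
  have := @sum_zero_sum_poly_le_mode R d n p l Q z b (fun j => m j : nat)
    pQ zP d3 n0 nl mn b1 equi x1 dx tW td tD tb te.
  rewrite (multinomial_modeE d0 n0 mn) -/err -/q => main.
  have qM0 : 0 < \prod_j q j ^+ (d * m j).
    (* If [m j = 0], then [q j] vanishes, but the factor is [0 ^+ 0 = 1]. *)
    apply: prodr_gt0 => j _; rewrite /q; case: (nat_of_ord (m j)) => [|k].
      by rewrite muln0 expr0.
    by rewrite exprn_gt0 // divr_gt0 ?ltr0n.
  have Wle : W * \prod_j q j ^+ (d * m j) * l.+1%:R ^+ p * p%:R ^+ n <=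
      l.+1%:R ^+ p * (p%:R * err * (\prod_j q j ^+ (d * m j) *
      ((d * n)`!%:R / (\prod_j (d * m j)`!)%N%:R))).
    apply: le_trans main; rewrite Wfourier.
    apply: (le_trans (ler_wpM2r _ (le_normc_sum _ _ _))).
      by rewrite exprn_ge0.
    rewrite mulr_suml; apply: ler_sum => a _.
    rewrite !Normc.normcM !normcX exprMn mulrC Normc.normcV.
    rewrite normc_prod big1; last first.
      by move=> j _; rewrite !normcX (normc_prim_root zP) !expr1n.
    rewrite invr1 mulr1 ler_wpM2r ?exprn_ge0 ?normc_ge0 //.
    by rewrite -(rmorph_nat (real_complex R)) normcR.
  have lp0 : 0 < l.+1%:R ^+ p :> R by rewrite exprn_gt0 ?ltr0n.
  have pn0 : 0 < p%:R ^+ n :> R by rewrite exprn_gt0.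
  have N0 : 0 < (d * n)`!%:R :> R by rewrite ltr0n fact_gt0.
  have F0 : 0 < (\prod_j (d * m j)`!)%N%:R :> R.
    by rewrite ltr0n prodn_gt0 // => j; exact: fact_gt0.
  rewrite [leRHS]mulrC -mulrA; apply: ler_wpM2l => //.
  rewrite mulrC mulrA ler_pdivrMr // -ler_pdivlMr //.
  rewrite -(ler_pM2r (mulr_gt0 (mulr_gt0 qM0 lp0) pn0)) !mulrA.
  apply: le_trans Wle _.
  rewrite le_eqVlt; apply/orP; left; apply/eqP; field.
  by rewrite !gt_eqF.
apply: le_trans (ler_sum _ term_le) _.
apply: (@le_trans _ _ (\sum_(m : {ffun 'I_p -> 'I_n.+1} |
    ((\sum_j m j)%N == n) && (p %| \sum_j m j * j)%N)
    p%:R * err / p%:R ^+ n * multinomial m)).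
  rewrite [leLHS]big_mkcond [leRHS]big_mkcond /=; apply: ler_sum => m _.
  have v0 : 0 <= p%:R * err / p%:R ^+ n * multinomial m :> R.
    by rewrite mulr_ge0 ?divr_ge0 ?mulr_ge0 ?exprn_ge0.
  rewrite inE; case: ifP => [/andP[-> _] //|_]; by case: ifP.
rewrite -mulr_sumr.
have -> (u v s : R) : p%:R * u / v * s = u * ((p%:R * s) / v) by ring.
by rewrite ler_piMr // ler_pdivrMr ?exprn_gt0 // mul1r sum_multinomial_le.
Qed.

End NonAsymptotic.

(** * Passage to the limit *)

Section Asymptotics.
Context {R : realType}.

Lemma near_ln_ge (A : R) : \forall n \near \oo, A <= ln (n%:R : R).
Proof.
near=> n; rewrite -[A]expRK ler_ln ?posrE ?expR_gt0 //.
- by near: n; exact: nbhs_infty_ger.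
- by rewrite ltr0n; near: n; exact: nbhs_infty_gt.
Unshelve. all: by end_near. Qed.

(** With [x = ln n], the bound on [p] gives [p ^ 3 / n <= expR (- (3 * eps * x))], and the Taylor
    term of degree 4 of the exponential beats [x ^ 3]. *)
Lemma cvg_cube_ratio (p : nat -> nat) (eps : R) : 0 < eps ->
  (\forall n \near \oo, (p n)%:R <= (n%:R : R) `^ (3^-1 - eps)) ->
  (fun n => (p n)%:R ^+ 3 * ln n%:R ^+ 3 / n%:R : R) @ \oo --> (0 : R).
Proof.
move=> e0 hp; apply/cvgrPdist_le => e ee; near=> n.
have n0 : 0 < n%:R :> R by rewrite ltr0n; near: n; exact: nbhs_infty_gt.
have x1 : 1 <= ln n%:R :> R by near: n; exact: near_ln_ge.
have xK : 24 / (3 * eps) ^+ 4 / e <= ln n%:R by near: n; exact: near_ln_ge.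
have pn : (p n)%:R <= (n%:R : R) `^ (3^-1 - eps) by near: n.
set x : R := ln n%:R in x1 xK *.
have nE : n%:R = expR x :> R by rewrite lnK.
have y0 : 0 < 3 * eps by rewrite mulr_gt0.
rewrite sub0r normrN ger0_norm; last first.
  by rewrite divr_ge0 // mulr_ge0 // exprn_ge0 //; lra.
have p3 : (p n)%:R ^+ 3 <= n%:R * expR (- (3 * eps * x)).
  apply: (@le_trans _ _ (((n%:R : R) `^ (3^-1 - eps)) ^+ 3)).
    by rewrite lerXn2r ?nnegrE ?powR_ge0.
  rewrite [X in X * _]nE -expRD nE /powR gt_eqF ?expR_gt0 // expRK -expRM_natr.
  by rewrite ler_expR le_eqVlt; apply/orP; left; apply/eqP; field.
apply: (@le_trans _ _ (expR (- (3 * eps * x)) * x ^+ 3)).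
  rewrite ler_pdivrMr // [leRHS]mulrC [leRHS]mulrA; apply: ler_wpM2r => //.
  by rewrite exprn_ge0 //; lra.
rewrite expRN mulrC ler_pdivrMr ?expR_gt0 //.
have xx : 0 <= 3 * eps * x by rewrite mulr_ge0 ?ltW //; lra.
apply: (@le_trans _ _ (e * ((3 * eps * x) ^+ 4 / 4`!%:R))); last first.
  by apply: ler_wpM2l (le_trans _ (expR_ge1Dxn 3 xx)); [exact: ltW | rewrite lerDr].
have x30 : 0 <= x ^+ 3 by rewrite exprn_ge0 //; lra.
have -> : e * ((3 * eps * x) ^+ 4 / 4`!%:R) =
    x ^+ 3 * (x / (24 / (3 * eps) ^+ 4 / e)).
  by have -> : (4`! = 24)%N by []; field; rewrite !gt_eqF.
by rewrite ler_peMr // ler_pdivlMr ?mul1r // !divr_gt0 ?exprn_gt0.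
Unshelve. all: by end_near. Qed.

Lemma cvg_error_factor d (b : R) (t : nat -> R) : t @ \oo --> (0 : R) ->
  (fun n => error_factor d b (t n) - 1) @ \oo --> (0 : R).
Proof.
move=> t0.
have lin (c : R) : (fun n => c * t n) @ \oo --> (0 : R).
  by rewrite -[X in _ --> X](mulr0 c); apply: cvgMr.
rewrite -(subrr (1 : R)); apply: cvgB; last exact: cvg_cst.
rewrite -[X in _ --> X]add0r; apply: cvgD => //.
rewrite -[X in _ --> X](mulr1 1); apply: cvgM.
  rewrite -[X in _ --> X]expR0; apply: continuous_cvg.
    exact: continuous_expR.
  rewrite -[X in _ --> X](addr0 0); apply: cvgD => //.
  rewrite -[X in _ --> X](mulr0 2); apply: cvgMr.
  rewrite -[X in _ --> X](@sqrtr0 R); apply: continuous_cvg => //.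
  exact: sqrt_continuous.
rewrite -[X in _ --> X]invr1; apply: cvgV; first exact: oner_neq0.
by rewrite -[X in _ --> X]subr0; apply: cvgB => //; exact: cvg_cst.
Qed.

End Asymptotics.

Theorem proposition2p5 (R : realType) (d : nat) (hd : (3 <= d)%N) :
  exists2 eps0 : R, 0 < eps0 & forall eps : R, 0 < eps -> eps < eps0 ->
  exists2 b0 : R, 0 < b0 & forall b : R, b0 <= b ->
  forall p : nat -> nat,
    (\forall n \near \oo, prime (p n)) ->
    p @ \oo --> \oo ->
    (\forall n \near \oo, (p n)%:R <= (n%:R : R) `^ (3^-1 - eps)) ->
  forall (disp : nat -> measure_display)
    (T : forall n : nat, measurableType (disp n))
    (P : forall n : nat, probability (T n) R)
    (X : forall n : nat, 'I_n -> T n -> {ffun 'I_(p n) -> nat}),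
    (forall (n : nat) (i : 'I_n), discrete_rv (X n i)) ->
    (forall (n : nat) (i : 'I_n), uniform_over (P n) (U d (p n)) (X n i)) ->
    (forall n : nat, mutually_independent (P n) (X n)) ->
  exists2 u : nat -> R, u @ \oo --> 0 &
    \forall n \near \oo, equidistributed_sum d b (P n) (X n) <= 1 + u n.
Proof.
exists 1 => // eps e0 _; exists 1 => // b b1 p p_pr p_oo p_le disp T P X Xm Xu Xi.
pose t n : R := (p n)%:R ^+ 3 * ln n%:R ^+ 3 / n%:R.
have t0 : t @ \oo --> (0 : R) by exact: cvg_cube_ratio e0 p_le.
have small (c e : R) : 0 < e -> \forall n \near \oo, c * t n <= e.
  move=> ee; have ct0 : (fun n => c * t n) @ \oo --> (0 : R).
    by rewrite -[X in _ --> X](mulr0 c); apply: cvgMr.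
  exact: cvgr_le ct0 _ ee.
exists (fun n => error_factor d b (t n) - 1); first exact: cvg_error_factor.
near=> n; rewrite addrCA subrr addr0.
(* As [p] tends to infinity, it eventually exceeds [d] and so cannot divide it. *)
have pd : (d < p n)%N.
  by near: n; exact: (p_oo [set k | (d < k)%N] (nbhs_infty_gt d)).
apply: equidistributed_sum_le => //.
- by near: n.
- by rewrite gtnNdvd // (leq_trans _ hd).
- by near: n; exact: nbhs_infty_gt.
- by near: n; exact: near_ln_ge.
- by near: n; exact: near_ln_ge.
- by near: n; apply: small.
- by near: n; apply: small; rewrite divr_gt0.
- by near: n; apply: small; rewrite divr_gt0.
- by near: n; apply: small.
- by near: n; apply: small; rewrite divr_gt0.
Unshelve. all: by end_near. Qed.
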